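(* Consider an $N$-bus power network and the parametrized AC optimal power flow problem with parameter $\xi^{\mathrm{sh}}=(\widetilde g^{\mathrm{sh}},\widetilde b^{\mathrm{sh}})$ (the real and imaginary parts of the lumped nodal shunt admittances) ranging over a nonempty open set $\Xi^{\mathrm{sh}}\subseteq\mathbb{R}^{2N}$, $$\mathsf{P}(\xi^{\mathrm{sh}}):\qquad \min_{x\in\mathbb{R}^{4N}} f(x)\quad\text{subject to}\quad \widetilde h(x,\xi^{\mathrm{sh}})=0,\ \ h(x)=0,\ \ g(x)\le 0,$$ where $\widetilde h(x,\xi^{\mathrm{sh}})=0$ are the AC power flow equations with lumped shunt admittances $\xi^{\mathrm{sh}}$, and $h:\mathbb{R}^{4N}\to\mathbb{R}^I$, $g:\mathbb{R}^{4N}\to\mathbb{R}^J$ are the operational constraints (not depending on $\xi^{\mathrm{sh}}$). Let $\mathcal{X}:=\{x\in\mathbb{R}^{4N}\mid h(x)=0,\ g(x)\le 0\}$. Assume that $g$ and $h$ are of class $C^r$ with $r>2N$ at all $x\in\mathcal{X}$, and that for all $x\in\mathcal{X}$ $$\operatorname{rank}\begin{bmatrix}\nabla h(x)\\ \nabla g_{\mathbf{J}(x)}(x)\end{bmatrix}=I+|\mathbf{J}(x)|,\qquad \mathbf{J}(x):=\{j\mid g_j(x)=0\}.$$ Assume furthermore that $g$ and $h$ are such that every $x=(p^{\mathrm G},q^{\mathrm G},v,\theta)\in\mathcal{X}$ satisfies $v_k>0$ for all $k=1,\dots,N$. Then, for almost every $\xi^{\mathrm{sh}}\in\Xi^{\mathrm{sh}}$,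 the linear independence constraint qualification (LICQ) for $\mathsf{P}(\xi^{\mathrm{sh}})$ holds at every $x$ that is feasible for $\mathsf{P}(\xi^{\mathrm{sh}})$.
   Context: Power flow equations: the network has nodes $1,\dots,N$ and lines between some pairs of nodes; $\mathbf{N}(k)$ is the set of nodes connected to $k$ by a line. Node $k$ has complex voltage $u_k=v_ke^{j\theta_k}$ ($j=\sqrt{-1}$), fixed load $p^{\mathrm L}_k+jq^{\mathrm L}_k$, variable generation $p^{\mathrm G}_k+jq^{\mathrm G}_k$, and a shunt admittance $y^{\mathrm{sh}}_k\in\mathbb{C}$. The line between $k$ and $l$ has fixed series admittance $y_{kl}\in\mathbb{C}$ and shunt admittance $y^{\mathrm{sh}}_{kl}\in\mathbb{C}$. The lumped shunt admittance at node $k$ is $\widetilde y^{\mathrm{sh}}_k=\widetilde g^{\mathrm{sh}}_k+j\widetilde b^{\mathrm{sh}}_k:=y^{\mathrm{sh}}_k+\tfrac12\sum_{i\in\mathbf{N}(k)}y^{\mathrm{sh}}_{ki}$. The nodal admittance matrix $Y=Y(\xi^{\mathrm{sh}})\in\mathbb{C}^{N\times N}$ has entries $[Y]_{kk}=\widetilde y^{\mathrm{sh}}_k+\sum_{i\in\mathbf{N}(k)}y_{ki}$, $[Y]_{kl}=-y_{kl}$ for $l\in\mathbf{N}(k)$, and $0$ otherwise. With $x=(p^{\mathrm G},q^{\mathrm G},v,\theta)\in\mathbb{R}^{4N}$, the AC power flow equations are $$\widetilde h(x,\xi^{\mathrm{sh}})=\begin{bmatrix}p^{\mathrm G}-p^{\mathrm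 L}-\operatorname{Re}\{\operatorname{diag}(u)(Y(\xi^{\mathrm{sh}})u)^*\}\\ q^{\mathrm G}-q^{\mathrm L}-\operatorname{Im}\{\operatorname{diag}(u)(Y(\xi^{\mathrm{sh}})u)^*\}\end{bmatrix}=0\in\mathbb{R}^{2N},$$ where $(\cdot)^*$ is the (entrywise) complex conjugate. The cost $f:\mathbb{R}^{4N}\to\mathbb{R}$ is continuously differentiable. Inequalities between vectors are componentwise; $\nabla$ is the Jacobian; $g_{\mathbf{J}(x)}$ is the vector of the functions $g_j$, $j\in\mathbf{J}(x)$. ''Almost every'' means outside a set of Lebesgue measure zero in $\mathbb{R}^{2N}$. ''Of class $C^r$ at all $x\in\mathcal{X}$'' means $r$ times continuously differentiable on an open neighbourhood of $\mathcal{X}$. LICQ for $\mathsf{P}(\xi^{\mathrm{sh}})$ at a feasible point $x$ means that the matrix obtained by stacking $\nabla_x\widetilde h(x,\xi^{\mathrm{sh}})$, $\nabla h(x)$, $\nabla g_{\mathbf{J}(x)}(x)$ has rank $2N+I+|\mathbf{J}(x)|$. *)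

(* Defs.v *)
From mathcomp Require Export all_boot all_order all_algebra.
From mathcomp Require Export all_classical all_reals all_analysis.
From mathcomp Require Export complex.

Set Implicit Arguments.
Unset Strict Implicit.
Unset Printing Implicit Defensive.
Export numFieldNormedType.Exports.
Import Order.TTheory GRing.Theory Num.Theory.
Local Open Scope classical_set_scope.
Local Open Scope ring_scope.

(* [class_C r U f]: f is r times continuously differentiable on the open set U,
   i.e. differentiable on U with partial derivatives of class C^(r-1) on U.
   It is only meaningful for U open: [differentiable] and [continuous] refer to
   full neighbourhoods. *)
Fixpoint class_C (R : realType) (n : nat) (W : normedModType R) (r : nat)
    (U : set 'rV[R]_n) (f : 'rV[R]_n -> W) : Prop :=
  match r with
  | 0 => forall x, U x -> {for x, continuous f}
  | r'.+1 => (forall x, U x -> differentiable f x) /\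
             (forall i : 'I_n, class_C r' U (fun x => 'D_(delta_mx 0 i) f x))
  end.

Definition class_C_at (R : realType) (n : nat) (W : normedModType R) (r : nat)
    (X : set 'rV[R]_n) (f : 'rV[R]_n -> W) : Prop :=
  exists U : set 'rV[R]_n, [/\ open U, X `<=` U & class_C r U f].

(* The library's ['J f x] acts on row vectors from the right, hence the
   transposition: row i of [nabla f x] is the gradient of the i-th component. *)
Definition nabla (R : realType) (n m : nat) (f : 'rV[R]_n -> 'rV[R]_m)
    (x : 'rV[R]_n) : 'M[R]_(m, n) := ('J f x)^T.

Definition box (R : realType) (n : nat) (a b : 'rV[R]_n) : set 'rV[R]_n :=
  [set x | forall i, a 0 i <= x 0 i <= b 0 i].

Definition box_volume (R : realType) (n : nat) (a b : 'rV[R]_n) : R :=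
  \prod_(i < n) (b 0 i - a 0 i).

(* n-dimensional Lebesgue outer measure. The index predicate [D] lets the
   covering family be finite, or empty; this matters only for n = 0, where the
   empty set is not a box and every box has volume 1. *)
Definition lebesgue_outer_measure (R : realType) (n : nat)
    (A : set 'rV[R]_n) : \bar R :=
  ereal_inf [set v | exists (D : pred nat) (a b : nat -> 'rV[R]_n),
    [/\ forall k i, a k 0 i <= b k 0 i,
        A `<=` \bigcup_(k in [set k | D k]) box (a k) (b k) &
        v = (\sum_(0 <= k <oo | D k) (box_volume (a k) (b k))%:E)%E]].

Definition lebesgue_null (R : realType) (n : nat) (A : set 'rV[R]_n) : Prop :=
  lebesgue_outer_measure A = 0%E.

Definition for_almost_every_in (R : realType) (n : nat)
    (A : set 'rV[R]_n) (P : 'rV[R]_n -> Prop) : Prop :=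
  lebesgue_null [set x | A x /\ ~ P x].

(* Nodes 1..N are ['I_N]. [series_adm k l] is read only when [line k l]; the
   equality [series_adm k l = series_adm l k] is not required. The shunt
   admittances y^sh_k (nodes) and y^sh_kl (lines) are absent: the nodal
   admittance matrix sees them only through the lumped values
   y^sh_k + 1/2 \sum_(i in N(k)) y^sh_ki, which are the parameter xi below. *)
Record network (R : realType) (N : nat) := Network {
  line : rel 'I_N;
  line_sym : symmetric line;
  line_irr : irreflexive line;
  series_adm : 'I_N -> 'I_N -> R[i]
}.

(* x = (pG, qG, v, theta) in R^(4N) *)
Notation state_dim N := ((N + N) + (N + N))%N.

Section PowerFlow.
Context {R : realType} {N : nat}.
Implicit Types (x : 'rV[R]_(state_dim N)) (xi : 'rV[R]_(N + N)).

Definition st_pG x : 'rV[R]_N := lsubmx (lsubmx x).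
Definition st_qG x : 'rV[R]_N := rsubmx (lsubmx x).
Definition st_v x : 'rV[R]_N := lsubmx (rsubmx x).
Definition st_theta x : 'rV[R]_N := rsubmx (rsubmx x).

Definition voltage x : 'rV[R[i]]_N :=
  \row_k ((st_v x 0 k)%:C *
          (cos (st_theta x 0 k) +i* sin (st_theta x 0 k)))%C.

(* xi = (g, b) in R^(2N) encodes the lumped shunt admittances g_k + j b_k. *)
Definition lumped_shunt xi (k : 'I_N) : R[i] :=
  (lsubmx xi 0 k +i* rsubmx xi 0 k)%C.

Definition nodal_admittance (net : network R N) xi : 'M[R[i]]_N :=
  \matrix_(k, l)
    if k == l then lumped_shunt xi k + \sum_(i | line net k i) series_adm net k i
    else if line net k l then - series_adm net k l
    else 0.

(* diag(u) (Y u)^*, a column vector *)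
Definition nodal_power (net : network R N) xi x : 'cV[R[i]]_N :=
  diag_mx (voltage x) *m
  map_mx (@conjc R) (nodal_admittance net xi *m (voltage x)^T).

Definition power_flow (net : network R N) (pL qL : 'rV[R]_N) xi x :
    'rV[R]_(N + N) :=
  row_mx
    (st_pG x - pL - (map_mx (@complex.Re R) (nodal_power net xi x))^T)
    (st_qG x - qL - (map_mx (@complex.Im R) (nodal_power net xi x))^T).

End PowerFlow.

Record acopf (R : realType) (N nI nJ : nat) := ACOPF {
  opf_net : network R N;
  opf_pL : 'rV[R]_N;
  opf_qL : 'rV[R]_N;
  opf_cost : 'rV[R]_(state_dim N) -> R;
  opf_h : 'rV[R]_(state_dim N) -> 'rV[R]_nI;
  opf_g : 'rV[R]_(state_dim N) -> 'rV[R]_nJ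
}.

Section ACOPF.
Context {R : realType} {N nI nJ : nat}.
Implicit Types (P : acopf R N nI nJ) (xi : 'rV[R]_(N + N)).
Implicit Types (x : 'rV[R]_(state_dim N)).

Definition opf_pf P xi x : 'rV[R]_(N + N) :=
  power_flow (opf_net P) (opf_pL P) (opf_qL P) xi x.

Definition opf_X P : set 'rV[R]_(state_dim N) :=
  [set x | opf_h P x = 0 /\ forall j, opf_g P x 0 j <= 0].

Definition feasible P xi x : Prop :=
  [/\ opf_pf P xi x = 0, opf_h P x = 0 & forall j, opf_g P x 0 j <= 0].

Definition active P x : {set 'I_nJ} := finset (fun j => opf_g P x 0 j == 0).

(* The vector function g_S, whose components are the g_j, j in S. *)
Definition g_sub P (S : {set 'I_nJ}) x : 'rV[R]_#|S| :=
  \row_(k < #|S|) opf_g P x 0 (enum_val k).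

Definition operational_regular P x : Prop :=
  \rank (col_mx (nabla (opf_h P) x) (nabla (g_sub P (active P x)) x))
  = (nI + #|active P x|)%N.

Definition LICQ P xi x : Prop :=
  \rank (col_mx (nabla (opf_pf P xi) x)
          (col_mx (nabla (opf_h P) x) (nabla (g_sub P (active P x)) x)))
  = (2 * N + nI + #|active P x|)%N.

End ACOPF.

(* Main.v *)
Require Import Defs.
From HB Require Import structures.
From mathcomp Require Import ring lra zify.

(* Differentiating the power flow equations with respect to the shunts gives
   -v_k^2 and v_k^2 on the diagonal, so in the joint space of (xi, x) the
   gradients of all equality and active constraints with a given active set S
   are independent, while LICQ fails exactly when the x-parts of these gradients
   are dependent.  The claim is thus a parametric transversality statement: the
   projection to xi of the degenerate solutions is null.

   Solutions of dimension greater than that of xi require the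
   higher-differentiability part of Sard's theorem.  The only chart used is the
   graph of one scalar equation w = 0 with dw/dx_i <> 0, which eliminates one
   variable.  Eliminating x-variables, then xi-variables, reduces to a map T of
   the remaining variables, of which some (the fibre variables) satisfy
   d_x T = 0 on the degenerate set A.  As in Morse's argument, either the fibre
   derivatives of the functions already known to vanish on A vanish too, and
   T varies along fibres by one more power of the distance, or one of these
   functions eliminates a further fibre variable.  In the end
   |T(y) - T(x)| <= C |y - x|^r for x in A and y in the same fibre.
   A grid with steps 1/K in the fibre variables and K^-r in the others then
   covers T(A) by boxes of total volume O(1/K); since the non-fibre variables
   are not sliced, Fubini's theorem is not needed. *)

Set Implicit Arguments.
Unset Strict Implicit.
Unset Printing Implicit Defensive.
Import Order.TTheory GRing.Theory Num.Theory.
Local Open Scope classical_set_scope.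
Local Open Scope ring_scope.

(** * Partial derivatives and the class C^k *)

Section Calculus.
Context {R : realType}.

Definition pd n (i : 'I_n) (f : 'rV[R]_n -> R) : 'rV[R]_n -> R :=
  fun x => 'D_(delta_mx 0 i) f x.

Lemma differentiable_row (V : normedModType R) n (phi : V -> 'rV[R]_n) x :
  (forall i, differentiable (fun y => phi y 0 i) x) -> differentiable phi x.
Proof.
move=> dphi.
have -> : phi = \sum_(i < n) (fun y => phi y 0 i *: delta_mx 0 i).
  apply/funext => y; rewrite fct_sumE; exact: row_sum_delta.
by apply: differentiable_sum => i; exact: differentiableZl.
Qed.

Lemma differentiable_entry (V : normedModType R) n (phi : V -> 'rV[R]_n) x i :
  differentiable phi x -> differentiable (fun y => phi y 0 i) x.
Proof.
move=> dphi; apply: (@differentiable_comp _ _ _ _ phi (fun M : 'rV[R]_n => M 0 i)) => //.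
exact: differentiable_coord.
Qed.

Lemma derive_entry (V : normedModType R) n (phi : V -> 'rV[R]_n) x v i :
  differentiable phi x -> 'D_v (fun y => phi y 0 i) x = ('D_v phi x) 0 i.
Proof. by move=> dphi; rewrite derive_mx ?mxE //; exact: diff_derivable. Qed.

Lemma derive_comp (V : normedModType R) n (phi : V -> 'rV[R]_n)
    (f : 'rV[R]_n -> R) x v :
  differentiable phi x -> differentiable f (phi x) ->
  'D_v (f \o phi) x = \sum_(i < n) pd i f (phi x) * 'D_v (fun y => phi y 0 i) x.
Proof.
move=> dphi df; rewrite deriveE; last exact: differentiable_comp.
rewrite diff_comp //= -(deriveE _ dphi) (row_sum_delta ('D_v phi x)) linear_sum.
apply: eq_bigr => i _; rewrite linearZ /= derive_entry // /pd (deriveE _ df).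
exact: mulrC.
Qed.

Lemma pd_near n (i : 'I_n) (f g : 'rV[R]_n -> R) x :
  (\near x, f x = g x) -> pd i f x = pd i g x.
Proof. exact: near_eq_derive. Qed.


Lemma differentiableP_eps (V W : normedModType R) (f : V -> W) x
    (df : {linear V -> W}) :
  continuous df ->
  (forall e : R, 0 < e ->
    \forall h \near 0, `|f (h + x) - (f x + df h)| <= e * `|h|) ->
  differentiable f x /\ 'd f x = df :> (V -> W).
Proof.
move=> cdf fdf.
have E : f \o shift x = cst (f x) + df +o_ 0 id.
  apply/eqaddoP => e e0; have := fdf e e0; apply: filterS => h.
  by rewrite !fctE.
have dE := diff_unique cdf E.
by split=> //; apply/diff_locallyP; rewrite dE.
Qed.

Lemma differentiable_eps (V W : normedModType R) (f : V -> W) x (e : R) :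
  differentiable f x -> 0 < e ->
  \forall h \near 0, `|f (h + x) - (f x + 'd f x h)| <= e * `|h|.
Proof.
move=> /diff_locally /eqaddoP df e0; have := df e e0; apply: filterS => h.
by rewrite !fctE.
Qed.

Lemma differentiable_near (V W : normedModType R) (f g : V -> W) x :
  (\near x, f x = g x) -> differentiable f x -> differentiable g x.
Proof.
move=> fg df.
apply: proj1 (differentiableP_eps (df := 'd f x) _ _) => [|e e0].
  exact: diff_continuous.
have fgx := nbhs_singleton fg.
have := differentiable_eps df e0; rewrite (near_shift 0 x) subr0 in fg.
apply: filterS2 fg => h /= fgh.
by rewrite -fgx -fgh.
Qed.
End Calculus.

(** * Closure properties of the class C^k *)

Section ClassC.
Context {R : realType}.
Implicit Types k n : nat.

Lemma class_C_differentiable n k (U : set 'rV[R]_n) (f : 'rV[R]_n -> R) x :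
  class_C k.+1 U f -> U x -> differentiable f x.
Proof. by case=> df _; exact: df. Qed.

Lemma class_C_pd n k (U : set 'rV[R]_n) (f : 'rV[R]_n -> R) i :
  class_C k.+1 U f -> class_C k U (pd i f).
Proof. by case=> _; exact. Qed.

Lemma class_CW n k (U : set 'rV[R]_n) (f : 'rV[R]_n -> R) :
  class_C k.+1 U f -> class_C k U f.
Proof.
elim: k f => [|k IH] f [df dk]; first by move=> x /df; exact: differentiable_continuous.
by split=> // i; apply: IH; exact: dk.
Qed.

Lemma class_C_le n k l (U : set 'rV[R]_n) (f : 'rV[R]_n -> R) :
  (l <= k)%N -> class_C k U f -> class_C l U f.
Proof.
move=> /subnK <-; elim: (k - l)%N => [|d IH] //.
by rewrite addSn => /class_CW.
Qed.

Lemma class_C_continuous n k (U : set 'rV[R]_n) (f : 'rV[R]_n -> R) x :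
  class_C k U f -> U x -> {for x, continuous f}.
Proof. by move=> /(class_C_le (leq0n k)) cf; exact: cf. Qed.

(** As [U] is open, functions that agree on [U] agree near each of its points. This replaces a
    derivative by a formula valid on [U] only, which drives the inductions on [k] below. *)
Lemma class_C_ext n k (U : set 'rV[R]_n) (f g : 'rV[R]_n -> R) :
  open U -> (forall x, U x -> f x = g x) -> class_C k U f -> class_C k U g.
Proof.
move=> oU.
have nearU h1 h2 : (forall x, U x -> h1 x = h2 x) ->
    forall x, U x -> \near x, h1 x = h2 x :> R.
  move=> h12 x Ux; have Unx : nbhs x U by apply: open_nbhs_nbhs.
  by apply: filterS Unx => y; exact: h12.
elim: k f g => [|k IH] f g fg /=.
  move=> cf x Ux; have := cf _ Ux.
  rewrite /prop_for /continuous_at -(fg x Ux) => cfx; apply: cvg_trans cfx.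
  exact: (near_eq_cvg (nearU _ _ fg x Ux)).
move=> [df dk]; split=> [x Ux|i].
  by apply: differentiable_near (df x Ux); exact: nearU.
apply: (IH (pd i f)) (dk i) => x Ux; exact/pd_near/nearU.
Qed.

Lemma class_C_cst n k (U : set 'rV[R]_n) (c : R) : class_C k U (fun _ => c).
Proof.
elim: k c => [|k IH] c /=; first by move=> x _; exact: cst_continuous.
split=> [x _|i]; first exact: differentiable_cst.
have -> : (fun x : 'rV[R]_n => 'D_'e_i (fun _ => c) x) = fun _ => 0.
  by apply/funext => x; rewrite derive_cst.
exact: IH.
Qed.

Lemma class_C_D n k (U : set 'rV[R]_n) (f g : 'rV[R]_n -> R) :
  open U -> class_C k U f -> class_C k U g -> class_C k U (fun x => f x + g x).
Proof.
move=> oU; elim: k f g => [|k IH] f g.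
  by move=> cf cg x Ux; apply: continuousD; [exact: cf|exact: cg].
move=> [df dkf] [dg dkg]; split=> [x Ux|i].
  by apply: differentiableD; [exact: df|exact: dg].
apply: class_C_ext (IH _ _ (dkf i) (dkg i)) => // x Ux.
by rewrite deriveD //; apply: diff_derivable; [exact: df|exact: dg].
Qed.

Lemma class_C_M n k (U : set 'rV[R]_n) (f g : 'rV[R]_n -> R) :
  open U -> class_C k U f -> class_C k U g -> class_C k U (fun x => f x * g x).
Proof.
move=> oU; elim: k f g => [|k IH] f g cf cg.
  by move=> x Ux; apply: continuousM; [exact: cf|exact: cg].
have [df dkf] := cf; have [dg dkg] := cg; split=> [x Ux|i].
  by apply: differentiableM; [exact: df|exact: dg].
have := class_C_D oU (IH _ _ (class_CW cf) (dkg i)) (IH _ _ (class_CW cg) (dkf i)).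
apply: class_C_ext => // x Ux.
by rewrite deriveM //; apply: diff_derivable; [exact: df|exact: dg].
Qed.

Lemma class_C_N n k (U : set 'rV[R]_n) (f : 'rV[R]_n -> R) :
  open U -> class_C k U f -> class_C k U (fun x => - f x).
Proof.
move=> oU cf; have := class_C_M oU (class_C_cst k U (-1)) cf.
by apply: class_C_ext => // x _; rewrite mulN1r.
Qed.

Lemma class_C_B n k (U : set 'rV[R]_n) (f g : 'rV[R]_n -> R) :
  open U -> class_C k U f -> class_C k U g -> class_C k U (fun x => f x - g x).
Proof. by move=> oU cf cg; apply: class_C_D => //; exact: class_C_N. Qed.

Lemma class_C_sum n k (U : set 'rV[R]_n) (I : Type) (s : seq I) (P : pred I)
    (f : I -> 'rV[R]_n -> R) :
  open U -> (forall i, P i -> class_C k U (f i)) ->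
  class_C k U (fun x => \sum_(i <- s | P i) f i x).
Proof.
move=> oU cf; elim: s => [|i s IH].
  by apply: class_C_ext (class_C_cst k U 0) => // x _; rewrite big_nil.
have [Pi|nPi] := boolP (P i).
  by apply: class_C_ext (class_C_D oU (cf i Pi) IH) => // x _; rewrite big_cons Pi.
by apply: class_C_ext IH => // x _; rewrite big_cons (negbTE nPi).
Qed.

Lemma pd_coord n (i j : 'I_n) (x : 'rV[R]_n) :
  pd i (fun y : 'rV[R]_n => y 0 j) x = (i == j)%:R.
Proof.
rewrite /pd (derive_entry (phi := id)) ?derive_id ?mxE ?eqxx //=.
by rewrite eq_sym.
Qed.

Lemma class_C_coord n k (U : set 'rV[R]_n) (j : 'I_n) :
  class_C k U (fun x : 'rV[R]_n => x 0 j).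
Proof.
case: k => [|k] /=.
  by move=> x _; apply: coord_continuous.
split=> [x _|i]; first exact: differentiable_coord.
have -> : (fun x : 'rV[R]_n => 'D_'e_i (fun y : 'rV[R]_n => y 0 j) x) =
    fun _ => (i == j)%:R by apply/funext => x; exact: pd_coord.
exact: class_C_cst.
Qed.

Lemma continuous_row (T : topologicalType) n (phi : T -> 'rV[R]_n) x :
  (forall i, {for x, continuous (fun y => phi y 0 i)}) -> {for x, continuous phi}.
Proof.
move=> cphi.
apply/cvgrPdist_le => e e0; near=> y.
rewrite /Num.Def.normr /= mx_normrE (bigmax_le _ (ltW e0)) //= => -[i j] _.
rewrite !mxE /= !ord1; move: j; near: y; apply: filter_forall => j.
exact: ((cvgrPdist_le _ _).1 (cphi j)).
Unshelve. all: by end_near. Qed.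

(** The chain rule gives sums of products of [pd i f \o phi] with derivatives of [phi]; the
    induction on [k] applies to the first factors. *)
Lemma class_C_comp n m k (U : set 'rV[R]_n) (V : set 'rV[R]_m)
    (phi : 'rV[R]_m -> 'rV[R]_n) (f : 'rV[R]_n -> R) :
  open V -> (forall x, V x -> U (phi x)) ->
  (forall i, class_C k V (fun x => phi x 0 i)) -> class_C k U f ->
  class_C k V (f \o phi).
Proof.
move=> oV VU; elim: k f => [|k IH] f cphi cf.
  move=> x Vx; apply: continuous_comp; last by apply: cf; exact: VU.
  by apply: continuous_row => i; exact: cphi.
have dphi x : V x -> differentiable phi x.
  by move=> Vx; apply: differentiable_row => i; exact: class_C_differentiable (cphi i) Vx.
split=> [x Vx|j].
  apply: differentiable_comp; first exact: dphi.
  by apply: (class_C_differentiable cf); exact: VU.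
have : class_C k V (fun x => \sum_(i < n) (pd i f \o phi) x *
    pd j (fun y => phi y 0 i) x).
  apply: class_C_sum => // i _; apply: class_C_M => //.
    by apply: IH => [l|]; [exact: class_CW|exact: class_C_pd].
  exact: class_C_pd.
apply: class_C_ext => // x Vx; rewrite derive_comp //; first exact: dphi.
by apply: (class_C_differentiable cf); exact: VU.
Qed.

Lemma class_C_V n k (U : set 'rV[R]_n) (f : 'rV[R]_n -> R) :
  open U -> (forall x, U x -> f x != 0) -> class_C k U f ->
  class_C k U (fun x => (f x)^-1).
Proof.
move=> oU f0; elim: k => [|k IH] cf.
  by move=> x Ux; exact: (continuousV (f0 x Ux) (cf x Ux)).
have df := class_C_differentiable cf.
split=> [x Ux|i]; first by apply: differentiableV; [exact: df|exact: f0].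
have iC := IH (class_CW cf).
have := class_C_N oU (class_C_M oU (class_C_M oU iC iC) (class_C_pd i cf)).
apply: class_C_ext => // x Ux.
rewrite deriveV; [|exact: f0|exact/diff_derivable/df].
by rewrite -invfM -expr2 -mulNr.
Qed.

Lemma class_C_entry n m k (U : set 'rV[R]_n) (f : 'rV[R]_n -> 'rV[R]_m) j :
  open U -> class_C k U f -> class_C k U (fun x => f x 0 j).
Proof.
move=> oU; elim: k f => [|k IH] f.
  move=> cf x Ux.
  apply: (@continuous_comp _ _ _ f (fun M : 'rV[R]_m => M 0 j) x (cf x Ux)).
  exact: coord_continuous.
move=> [df dk]; split=> [x Ux|i]; first exact/differentiable_entry/df.
apply: class_C_ext (IH _ (dk i)) => // x Ux.
by rewrite derive_entry //; exact: df.
Qed.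

(** Each derivative involves the other function, so one induction treats both. *)
Lemma class_C_cos_sin n k (U : set 'rV[R]_n) (f : 'rV[R]_n -> R) :
  open U -> class_C k U f ->
  class_C k U (fun x => cos (f x)) /\ class_C k U (fun x => sin (f x)).
Proof.
move=> oU; elim: k => [|k IH] cf.
  by split=> x Ux; apply: (continuous_comp (cf x Ux));
    [exact: continuous_cos|exact: continuous_sin].
have df := class_C_differentiable cf.
have [cC sC] := IH (class_CW cf).
have dcos (y : R) : differentiable (@cos R) y by apply/derivable1_diffP; exact: derivable_cos.
have dsin (y : R) : differentiable (@sin R) y by apply/derivable1_diffP; exact: derivable_sin.
have chain (g dg : R -> R) x i : U x -> is_derive (f x) 1 g (dg (f x)) ->
    'D_(delta_mx 0 i) (fun y => g (f y)) x = dg (f x) * pd i f x.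
  move=> Ux Dg; have /derivable1_diffP dgx : derivable g (f x) 1 by case: Dg.
  have dfg : differentiable (g \o f) x by apply: differentiable_comp => //; exact: df.
  rewrite (deriveE _ dfg) diff_comp //=; last exact: df.
  rewrite /pd (deriveE _ (df x Ux)) -[X in 'd g _ X = _]mulr1 linearZ /= -(deriveE _ dgx).
  by have [_ ->] := Dg; exact: mulrC.
split; split=> [x Ux|i].
- by apply: differentiable_comp; [exact: df|exact: dcos].
- have := class_C_N oU (class_C_M oU sC (class_C_pd i cf)).
  by apply: class_C_ext => // x Ux; rewrite (chain _ (fun y => - sin y)) ?mulNr.
- by apply: differentiable_comp; [exact: df|exact: dsin].
- have := class_C_M oU cC (class_C_pd i cf).
  by apply: class_C_ext => // x Ux; rewrite (chain _ cos).
Qed.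

End ClassC.

(** * Mean value inequalities *)

Section MeanValue.
Context {R : realType}.

Lemma rV_norm_leP n (x : 'rV[R]_n) (e : R) : 0 <= e ->
  (`|x| <= e) <-> (forall i, `|x 0 i| <= e).
Proof.
move=> e0; rewrite -[`|x|]/(mx_norm x) mx_normrE; split=> [xe i|xe].
  by apply: le_trans xe; exact: (le_bigmax _ (fun ij => `|x ij.1 ij.2|) (0, i)).
apply: bigmax_le => //= -[i j] _ /=. rewrite ord1; exact: xe.
Qed.

Lemma rV_entry_le n (x : 'rV[R]_n) i : `|x 0 i| <= `|x|.
Proof. by move: i; apply/rV_norm_leP. Qed.

Lemma rV_ballP n (x y : 'rV[R]_n) (e : R) : 0 < e ->
  ball x e y <-> forall i, `|y 0 i - x 0 i| < e.
Proof.
move=> e0; rewrite -ball_normE /ball_ /=; split=> [xy i|xy].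
  by rewrite distrC; apply: le_lt_trans xy; have := rV_entry_le (x - y) i; rewrite !mxE.
rewrite -[`|x - y|]/(mx_norm (x - y)) mx_normrE; apply: bigmax_lt => //= -[i j] _ /=.
by rewrite ord1 !mxE distrC.
Qed.

(** The scalar mean value theorem for [f \o gam], expanded by the chain rule. Curves are needed
    besides segments because graph maps bend the fibres. *)
Lemma curve_mean_value n (f : 'rV[R]_n -> R) (gam : R -> 'rV[R]_n) (t : R) :
  0 <= t ->
  (forall s : R, 0 <= s <= t -> differentiable gam s /\ differentiable f (gam s)) ->
  exists2 s, 0 <= s <= t & f (gam t) - f (gam 0) =
    (\sum_(i < n) pd i f (gam s) * 'D_1 (fun u => gam u 0 i) s) * t.
Proof.
move=> t0 df.
have dfg s : 0 <= s <= t -> differentiable (f \o gam) s.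
  by move=> /df[dg dfs]; exact: differentiable_comp.
have [||s st E] := @MVT_segment R (f \o gam) (fun s => 'D_1 (f \o gam) s) 0 t t0.
- move=> s; rewrite in_itv /= => /andP[s0 st].
  apply: DeriveDef => //; apply: diff_derivable; apply: dfg.
  by rewrite !ltW.
- apply: derivable_within_continuous => s; rewrite in_itv /= => st.
  by apply: diff_derivable; exact: dfg.
exists s; first by rewrite in_itv in st.
rewrite in_itv /= in st; have [dg dfs] := df _ st.
by rewrite subr0 derive_comp in E.
Qed.

Definition seg n (x y : 'rV[R]_n) (t : R) : 'rV[R]_n := x + t *: (y - x).

Lemma differentiable_seg n (x y : 'rV[R]_n) t : differentiable (seg x y) t.
Proof.
apply: differentiableD; first exact: differentiable_cst.
exact: differentiableZl.
Qed.

Lemma derive_seg n (x y : 'rV[R]_n) t i :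
  'D_1 (fun u => seg x y u 0 i) t = y 0 i - x 0 i.
Proof.
have -> : (fun u => seg x y u 0 i) = (fun u => x 0 i + u * (y 0 i - x 0 i)).
  by apply/funext => u; rewrite !mxE.
rewrite deriveD // derive_cst add0r deriveMr // derive_id.
by rewrite /GRing.scale /= mulr1.
Qed.

Lemma mean_value n (f : 'rV[R]_n -> R) x y :
  (forall t : R, 0 <= t <= 1 -> differentiable f (seg x y t)) ->
  exists2 t, 0 <= t <= 1 & f y - f x =
    \sum_(i < n) pd i f (seg x y t) * (y 0 i - x 0 i).
Proof.
move=> df; have [|s st] := @curve_mean_value n f (seg x y) 1 ler01.
  by move=> s st; split; [exact: differentiable_seg|exact: df].
rewrite /seg scale1r scale0r addr0 subrKC mulr1 => E; exists s => //.
by rewrite E; apply: eq_bigr => i _; rewrite derive_seg.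
Qed.

Lemma seg_box n (a x y : 'rV[R]_n) (rho : R) t : 0 <= t <= 1 ->
  (forall i, `|x 0 i - a 0 i| <= rho) -> (forall i, `|y 0 i - a 0 i| <= rho) ->
  forall i, `|seg x y t 0 i - a 0 i| <= rho.
Proof.
move=> /andP[t0 t1] xr yr i; rewrite !mxE.
have := xr i; have := yr i; rewrite !ler_norml => /andP[h1 h2] /andP[h3 h4].
by apply/andP; split; nra.
Qed.

End MeanValue.

(** * The scalar implicit function theorem *)

Section Insertion.
Context {R : realType} {n : nat}.
Implicit Types (i : 'I_n.+1) (y : 'rV[R]_n) (x : 'rV[R]_n.+1).

Definition ins i (t : R) y : 'rV[R]_n.+1 :=
  \row_j (if unlift i j is Some l then y 0 l else t).

Definition del i x : 'rV[R]_n := \row_l x 0 (lift i l).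

Lemma ins_i i t y : ins i t y 0 i = t.
Proof. by rewrite mxE unlift_none. Qed.

Lemma ins_lift i t y l : ins i t y 0 (lift i l) = y 0 l.
Proof. by rewrite mxE liftK. Qed.

Lemma ins_del i x : ins i (x 0 i) (del i x) = x.
Proof.
apply/rowP => j; case: (unliftP i j) => [l ->|->]; last by rewrite ins_i.
by rewrite ins_lift mxE.
Qed.

Lemma sum_lift (i : 'I_n.+1) (F : 'I_n.+1 -> R) :
  \sum_j F j = F i + \sum_l F (lift i l).
Proof. exact: bigD1_ord. Qed.

(** The candidate differential of the implicit function, made a linear map for
    [differentiableP_eps]. *)
Definition dotrow (m : 'I_n -> R) (y : 'rV[R]_n) : R := \sum_l m l * y 0 l.

Lemma dotrow_is_linear (m : 'I_n -> R) : linear (dotrow m : 'rV[R]_n -> R).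
Proof.
move=> c x y; rewrite /dotrow scaler_sumr -big_split /=; apply: eq_bigr => l _.
by rewrite !mxE mulrDr; congr (_ + _); rewrite /GRing.scale /= mulrCA.
Qed.

HB.instance Definition _ (m : 'I_n -> R) :=
  GRing.isLinear.Build R 'rV[R]_n R _ (dotrow m) (dotrow_is_linear m).

Lemma continuous_dotrow (m : 'I_n -> R) : continuous (dotrow m : 'rV[R]_n -> R).
Proof.
move=> y; apply: (@class_C_continuous _ n 0 setT (dotrow m) y _ I).
apply: class_C_sum => [|l _]; first exact: openT.
by apply: class_C_M; [exact: openT|exact: class_C_cst|exact: class_C_coord].
Qed.

Lemma dotrow_delta (m : 'I_n -> R) l : dotrow m (delta_mx 0 l) = m l.
Proof.
rewrite /dotrow (bigD1 l) //= mxE !eqxx mulr1 big1 ?addr0 // => j jl.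
by rewrite mxE eqxx (negbTE jl) mulr0.
Qed.

End Insertion.

Section ImplicitFunction.
Context {R : realType}.

Lemma nbhs_box n (a : 'rV[R]_n) (P : set 'rV[R]_n) : nbhs a P ->
  exists2 rho : R, 0 < rho &
    forall x : 'rV[R]_n, (forall j, `|x 0 j - a 0 j| <= rho) -> P x.
Proof.
move=> /nbhs_ballP[e /= e0 aP]; exists (e / 2); first by rewrite divr_gt0.
move=> x xe; apply/aP/rV_ballP => // j; apply: le_lt_trans (xe j) _.
by rewrite ltr_pdivrMr // ltr_pMr // ltr1n.
Qed.

Lemma near_pd_bounded n k (U : set 'rV[R]_n) (f : 'rV[R]_n -> R) a :
  open U -> U a -> class_C k.+1 U f ->
  exists2 B : R, 0 <= B & \forall x \near a, U x /\ forall j, `|pd j f x| <= B.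
Proof.
move=> oU Ua fC; exists (\sum_j `|pd j f a| + 1).
  by rewrite addr_ge0 // sumr_ge0.
have Unear : \forall x \near a, U x by apply: open_nbhs_nbhs.
suff bnear : \forall x \near a, forall j, `|pd j f x| <= \sum_j `|pd j f a| + 1.
  by apply: filterS2 Unear bnear => x.
apply: (@filter_forall _ _ (fun j x => `|pd j f x| <= _) (nbhs a)) => j.
have := class_C_continuous (class_C_pd j fC) Ua.
move=> /cvgrPdist_le /(_ 1 ltr01); apply: filterS => x /= h.
rewrite -(subrK (pd j f a) (pd j f x)) (le_trans (ler_normD _ _)) // addrC lerD //.
  by rewrite (bigD1 j) //= lerDl sumr_ge0.
by rewrite distrC.
Qed.

Section Positive.
Context {n k : nat} (U : set 'rV[R]_n.+1) (w : 'rV[R]_n.+1 -> R).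
Context (i : 'I_n.+1) (a : 'rV[R]_n.+1).
Hypothesis oU : open U.
Hypothesis Ua : U a.
Hypothesis wC : class_C k.+1 U w.
Hypothesis wa : w a = 0.
Hypothesis dwa : 0 < pd i w a.

Let inbox (rho : R) (x : 'rV[R]_n.+1) := forall j, `|x 0 j - a 0 j| <= rho.

(** By continuity of the partial derivatives, one box serves all the estimates; [c] is half of
    [pd i w a]. *)
Let box_bounds : exists rho c B : R, [/\ 0 < rho, 0 < c, 0 < B &
  forall x, inbox rho x -> [/\ U x, c <= pd i w x & forall j, `|pd j w x| <= B]].
Proof.
have [B B0 nB] := near_pd_bounded oU Ua wC.
have nc : \forall x \near a, pd i w a / 2 <= pd i w x.
  have := class_C_continuous (class_C_pd i wC) Ua.
  have d2 : 0 < pd i w a / 2 by rewrite divr_gt0.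
  move=> /cvgrPdist_le /(_ _ d2); apply: filterS => x /=.
  by rewrite ler_norml => /andP[_]; lra.
have [rho rho0 H] := nbhs_box (filterI nB nc).
exists rho, (pd i w a / 2), (B + 1); split=> //.
- by rewrite divr_gt0.
- by rewrite ltr_wpDl.
by move=> x /H[[Ux xB] cx]; split=> // j; rewrite (le_trans (xB j)) // lerDl.
Qed.

(** In the box, [w] has slope at least [c] in the i-th variable: the intermediate value theorem
    gives a zero, and the mean value theorem makes it unique and Lipschitz in the other variables.
    The bound on the derivatives of [psi] is kept to control the speed of curves lifted to the
    graph. *)
Lemma implicit_graph_pos :
  exists (W : set 'rV[R]_n.+1) (V : set 'rV[R]_n) (psi : 'rV[R]_n -> R) (B : R),
  [/\ open V, nbhs a W, 0 <= B, class_C k.+1 V psi &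
      (forall y, V y -> [/\ U (ins i (psi y) y), w (ins i (psi y) y) = 0,
          pd i w (ins i (psi y) y) != 0 & forall j,
          pd j psi y = - pd (lift i j) w (ins i (psi y) y) / pd i w (ins i (psi y) y)
          /\ `|pd j psi y| <= B]) /\
      (forall x, W x -> w x = 0 -> V (del i x) /\ x = ins i (psi (del i x)) (del i x))].
Proof.
have [rho [c [B [rho0 c0 B0 box]]]] := box_bounds.
have dw x : inbox rho x -> differentiable w x.
  by move=> /box[Ux _ _]; exact: class_C_differentiable wC Ux.
have mv x x' : inbox rho x -> inbox rho x' -> exists2 z, inbox rho z &
    w x' - w x = pd i w z * (x' 0 i - x 0 i)
      + \sum_l pd (lift i l) w z * (x' 0 (lift i l) - x 0 (lift i l)).
  move=> bx bx'; have [|t t01 ->] := @mean_value _ _ w x x'.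
    by move=> t t01; apply/dw/seg_box.
  exists (seg x x' t); first exact: seg_box.
  by rewrite (sum_lift i).
have sumB z (h : 'I_n -> R) (e : R) : inbox rho z -> 0 <= e -> (forall l, `|h l| <= e) ->
    `|\sum_l pd (lift i l) w z * h l| <= n%:R * B * e.
  move=> /box[_ _ zB] e0 he; apply: (le_trans (ler_norm_sum _ _ _)).
  apply: (@le_trans _ _ (\sum_(l < n) B * e)).
    by apply: ler_sum => l _; rewrite normrM ler_pM.
  by rewrite sumr_const card_ord -mulrA mulr_natl.
(* With this radius, moving the other variables changes [w] by at most [n%:R * B * s < c * rho], so
   [w] has opposite signs at the two ends of the i-th side. *)
pose s := c * rho / (c + n%:R * B).
have nB0 : 0 <= n%:R * B by rewrite mulr_ge0 // ltW.
have cnB0 : 0 < c + n%:R * B by rewrite ltr_wpDr.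
have s0 : 0 < s by rewrite divr_gt0 // mulr_gt0.
have s_rho : s <= rho.
  by rewrite ler_pdivrMr // mulrC ler_pM2l // lerDl.
have s_c : n%:R * B * s < c * rho.
  rewrite mulrA ltr_pdivrMr // mulrC ltr_pM2l ?mulr_gt0 //.
  by rewrite ltrDr.
pose V := ball (del i a) s.
have VP y : V y -> forall l, `|y 0 l - a 0 (lift i l)| < s.
  by move=> /(rV_ballP _ _ s0) h l; have := h l; rewrite mxE.
have ins_box y (t : R) : V y -> `|t - a 0 i| <= rho -> inbox rho (ins i t y).
  move=> Vy ht j; case: (unliftP i j) => [l ->|->]; last by rewrite ins_i.
  by rewrite ins_lift (le_trans (ltW (VP _ Vy l))).
have abox : inbox rho a by move=> j; rewrite subrr normr0 ltW.
pose zero y t := `|t - a 0 i| <= rho /\ w (ins i t y) = 0.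
have ex_zero y : V y -> exists t, zero y t.
  move=> Vy.
  have wE t : `|t - a 0 i| <= rho -> exists2 z, inbox rho z &
      `|w (ins i t y) - pd i w z * (t - a 0 i)| <= n%:R * B * s.
    move=> ht; have [z bz] := mv _ _ abox (ins_box _ _ Vy ht).
    rewrite wa subr0 ins_i => E; exists z => //.
    rewrite E addrC addKr; apply: sumB => //; first exact: ltW.
    by move=> l; rewrite ins_lift ltW // VP.
  have hp : 0 < w (ins i (a 0 i + rho) y).
    have [|z bz] := wE (a 0 i + rho); first by rewrite addrC addKr gtr0_norm.
    have [_ cz _] := box _ bz.
    rewrite ler_norml => /andP[h _].
    have := ler_wpM2r (ltW rho0) cz; lra.
  have hn : w (ins i (a 0 i - rho) y) < 0.
    have [|z bz] := wE (a 0 i - rho); first by rewrite addrC addKr normrN gtr0_norm.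
    have [_ cz _] := box _ bz.
    rewrite ler_norml => /andP[_ h].
    have := ler_wpM2r (ltW rho0) cz; lra.
  have le_ab : a 0 i - rho <= a 0 i + rho by lra.
  have itvE t : t \in `[a 0 i - rho, a 0 i + rho] -> `|t - a 0 i| <= rho.
    by rewrite in_itv /= ler_norml => /andP[h1 h2]; apply/andP; split; lra.
  have [||t tab wt] := @IVT R (fun t => w (ins i t y)) _ _ 0 le_ab.
  - apply: continuous_in_subspaceT => t; rewrite inE /= => /itvE ht.
    apply: (@continuous_comp _ _ _ (fun t => ins i t y) w).
      apply: continuous_row => j; case: (unliftP i j) => [l ->|->].
        have -> : (fun u => ins i u y 0 (lift i l)) = fun _ => y 0 l.
          by apply/funext => u; rewrite ins_lift.
        exact: cst_continuous.
      have -> : (fun u => ins i u y 0 i) = id.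
        by apply/funext => u; rewrite ins_i.
      by [].
    exact/differentiable_continuous/dw/ins_box.
  - by rewrite ge_min le_max (ltW hn) (ltW hp) orbT.
  by exists t; split=> //; exact: itvE.
pose psi y := xget 0 (zero y).
have psiP y : V y -> zero y (psi y).
  by move=> /ex_zero[t zt]; exact: (xgetPex 0 (ex_intro _ t zt)).
pose Psi y := ins i (psi y) y.
have Psi_box y : V y -> inbox rho (Psi y).
  by move=> Vy; apply: ins_box => //; case: (psiP _ Vy).
have wPsi y : V y -> w (Psi y) = 0 by move=> /psiP[].
(* As [w] is zero at both points, its change along the i-th variable balances that along the others.
   The case [e = 0] is the uniqueness of the zero. *)
have lip x x' (e : R) : inbox rho x -> inbox rho x' -> w x = 0 -> w x' = 0 ->
    0 <= e -> (forall l, `|x' 0 (lift i l) - x 0 (lift i l)| <= e) ->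
    `|x' 0 i - x 0 i| <= n%:R * B / c * e.
  move=> bx bx' wx wx' e0 he; have [z bz] := mv _ _ bx bx'.
  rewrite wx wx' subrr => /esym/eqP; rewrite addr_eq0 => /eqP E.
  have := sumB z _ e bz e0 he; have [_ cz _] := box _ bz.
  have z0 : 0 < pd i w z by apply: lt_le_trans cz.
  rewrite -normrN -E normrM (gtr0_norm z0) => h.
  rewrite mulrAC ler_pdivlMr // mulrC; apply: le_trans h.
  by rewrite ler_wpM2r.
exists (ball a s), V, psi, (B / c).
have oV : open V by exact: ball_open.
have dpsi y : V y -> differentiable psi y /\ forall j,
    pd j psi y = - pd (lift i j) w (Psi y) / pd i w (Psi y).
  move=> Vy; have bx := Psi_box _ Vy; have [Ux cx xB] := box _ bx.
  have dx0 : 0 < pd i w (Psi y) by apply: lt_le_trans cx.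
  pose m j := - pd (lift i j) w (Psi y) / pd i w (Psi y).
  suff [dpsi dE] : differentiable psi y /\ 'd psi y = dotrow m :> (_ -> _).
    by split=> // j; rewrite /pd deriveE // dE dotrow_delta.
  apply: differentiableP_eps; first exact: continuous_dotrow.
  move=> e e0.
  (* A Lipschitz constant of [Psi]. The tolerance [e * c / L1] absorbs it and the final division by
     [pd i w (Psi y) >= c]. *)
  pose L1 := 1 + n%:R * B / c.
  have L10 : 0 < L1 by rewrite ltr_wpDr // divr_ge0 // ltW.
  have e1 : 0 < e * c / L1 by rewrite divr_gt0 // mulr_gt0.
  have /nbhs_ballP[r /= r0 wr] := differentiable_eps (dw _ bx) e1.
  have nV : \forall h \near (0 : 'rV[R]_n), V (h + y).
    have : nbhs y V by apply: open_nbhs_nbhs.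
    by rewrite -[nbhs y V]/(\near y, V y) (near_shift 0 y) subr0.
  have nr : \forall h \near (0 : 'rV[R]_n), `|h| < r / L1.
    by apply: nbhs0_lt; rewrite divr_gt0.
  apply: filterS2 nV nr => h Vh hr.
  have dPsi : Psi (h + y) - Psi y = ins i (psi (h + y) - psi y) h.
    apply/rowP => j; case: (unliftP i j) => [l ->|->].
      by rewrite mxE [X in _ + X]mxE !ins_lift mxE addrK.
    by rewrite mxE [X in _ + X]mxE !ins_i.
  have hpsi : `|psi (h + y) - psi y| <= n%:R * B / c * `|h|.
    have := lip (Psi y) (Psi (h + y)) `|h| bx (Psi_box _ Vh) (wPsi _ Vy) (wPsi _ Vh)
      (normr_ge0 _).
    rewrite /Psi !ins_i; apply => l; rewrite !ins_lift mxE addrK.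
    exact: rV_entry_le.
  have hPsi : `|Psi (h + y) - Psi y| <= L1 * `|h|.
    rewrite dPsi; apply/rV_norm_leP; first by rewrite mulr_ge0 // ltW.
    move=> j; rewrite mulrDl mul1r; case: (unliftP i j) => [l ->|->].
      rewrite ins_lift (le_trans (rV_entry_le h l)) // lerDl.
      by rewrite mulr_ge0 // divr_ge0 // ltW.
    by rewrite ins_i (le_trans hpsi) // lerDr.
  (* As [w] vanishes at both points, its first-order expansion bounds the linear term itself, which
     is then solved for [psi (h + y) - psi y]. *)
  have := wr (Psi (h + y) - Psi y); rewrite -ball_normE /ball_ /= sub0r normrN.
  rewrite subrK wPsi // wPsi // !add0r normrN => H.
  have {H} H : `|'d w (Psi y) (Psi (h + y) - Psi y)| <= e * c / L1 * `|Psi (h + y) - Psi y|.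
    by apply: H; apply: le_lt_trans hPsi _; rewrite mulrC -ltr_pdivlMr.
  have {}H : `|'d w (Psi y) (Psi (h + y) - Psi y)| <= e * c * `|h|.
    apply: (le_trans H); rewrite -mulrA ler_pM2l ?mulr_gt0 //.
    by rewrite mulrC ler_pdivrMr // mulrC.
  have dwE (v : 'rV[R]_n.+1) : 'd w (Psi y) v = \sum_j pd j w (Psi y) * v 0 j.
    rewrite [in LHS](row_sum_delta v) linear_sum; apply: eq_bigr => j _.
    by rewrite linearZ /= /pd (deriveE _ (dw _ bx)); exact: mulrC.
  rewrite dwE (sum_lift i) dPsi ins_i in H.
  rewrite (eq_bigr (fun l => pd (lift i l) w (Psi y) * h 0 l)) in H; last first.
    by move=> l _; rewrite ins_lift.
  have -> : psi (h + y) - (psi y + dotrow m h) =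
    (pd i w (Psi y) * (psi (h + y) - psi y) +
     \sum_l pd (lift i l) w (Psi y) * h 0 l) / pd i w (Psi y).
    rewrite /dotrow mulrDl mulrAC divff ?gt_eqF // mul1r opprD addrA; congr (_ + _).
    rewrite mulr_suml -sumrN; apply: eq_bigr => l _; rewrite /m.
    by rewrite !mulNr opprK mulrAC.
  rewrite normrM normfV (gtr0_norm dx0) ler_pdivrMr //.
  apply: (le_trans H); rewrite -!mulrA ler_pM2l // mulrC ler_wpM2l //.
split=> //; [exact: nbhsx_ballx|by rewrite divr_ge0 // ltW| |].
  have PsiC l : class_C l V psi -> forall j, class_C l V (fun y => Psi y 0 j).
    move=> lC j; case: (unliftP i j) => [p ->|->].
      by apply: class_C_ext (class_C_coord l V p) => // y _; rewrite ins_lift.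
    by apply: class_C_ext lC => // y _; rewrite ins_i.
  have VU y : V y -> U (Psi y) by move=> /Psi_box/box[].
  have Vn0 y : V y -> (pd i w \o Psi) y != 0.
    by move=> /Psi_box/box[_ cy _]; rewrite /= gt_eqF // (lt_le_trans c0).
  (* Bootstrap: the derivatives of [psi] are quotients of derivatives of [w] composed with [Psi], so
     class [l] of [psi] yields class [l.+1]. *)
  have : forall l, (l <= k.+1)%N -> class_C l V psi.
    elim=> [|l IH] lk.
      by move=> y Vy; have [dy _] := dpsi _ Vy; exact: differentiable_continuous.
    split=> [y Vy|j]; first by case: (dpsi _ Vy).
    have lC := PsiC _ (IH (ltnW lk)).
    have wlC p : class_C l V (pd p w \o Psi).
      by apply: (class_C_comp (U := U)) => //; exact: class_C_le (class_C_pd p wC).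
    have := class_C_M oV (class_C_N oV (wlC (lift i j))) (class_C_V oV Vn0 (wlC i)).
    apply: class_C_ext => // y Vy; have [_] := dpsi _ Vy.
    by rewrite /pd => ->.
  exact.
split=> [y Vy|x /(rV_ballP _ _ s0) Wx wx].
  have [Ux cx xB] := box _ (Psi_box _ Vy); have [_ dE] := dpsi _ Vy.
  have dx0 : 0 < pd i w (Psi y) by apply: lt_le_trans cx.
  split=> //; [exact: wPsi|by rewrite gt_eqF|move=> j].
  split=> //; rewrite dE normrM normrN normfV (gtr0_norm dx0).
  by apply: ler_pM => //; rewrite ?invr_ge0 ?(ltW dx0) // lef_pV2.
have Vx : V (del i x) by apply/rV_ballP => // l; rewrite !mxE; exact: Wx.
split=> //; rewrite -[LHS](ins_del i); congr (ins i _ _).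
have bx : inbox rho x by move=> j; exact: le_trans (ltW (Wx j)) s_rho.
apply/eqP; rewrite -subr_eq0 -normr_le0.
have := lip _ _ 0 (Psi_box _ Vx) bx (wPsi _ Vx) wx (lexx _).
rewrite mulr0 /Psi ins_i; apply => l.
by rewrite ins_lift mxE subrr normr0.
Qed.

End Positive.

End ImplicitFunction.

Section ImplicitGraph.
Context {R : realType}.

Lemma pdN n (f : 'rV[R]_n -> R) i x : differentiable f x ->
  pd i (fun y => - f y) x = - pd i f x.
Proof. by move=> df; rewrite /pd deriveN //; exact: diff_derivable. Qed.

(** A negative [pd i w a] is treated through [- w]. The formula for [pd l (f \o Psi)] is a Gaussian
    elimination step with pivot [pd i w]; it carries relations between gradients through the
    graph. *)
Lemma implicit_graph n k (U : set 'rV[R]_n.+1) (w : 'rV[R]_n.+1 -> R)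
    (i : 'I_n.+1) (a : 'rV[R]_n.+1) :
  open U -> U a -> class_C k.+1 U w -> w a = 0 -> pd i w a != 0 ->
  exists (W : set 'rV[R]_n.+1) (V : set 'rV[R]_n) (Psi : 'rV[R]_n -> 'rV[R]_n.+1)
    (B : R), [/\ open V, nbhs a W, 0 <= B,
      forall j, class_C k.+1 V (fun y => Psi y 0 j) &
    [/\ forall y, V y -> [/\ U (Psi y), w (Psi y) = 0 & pd i w (Psi y) != 0],
        forall y l, Psi y 0 (lift i l) = y 0 l,
        forall f y l, V y -> differentiable f (Psi y) ->
          pd l (f \o Psi) y = pd (lift i l) f (Psi y) -
            pd (lift i l) w (Psi y) / pd i w (Psi y) * pd i f (Psi y),
        forall y l, V y -> `|pd l (fun z => Psi z 0 i) y| <= B &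
        forall x, W x -> w x = 0 -> V (del i x) /\ Psi (del i x) = x]].
Proof.
move=> oU Ua wC wa dwa.
have [W [V [psi [B [oV Wa B0 psiC [graph inv]]]]]] :
  exists (W : set 'rV[R]_n.+1) (V : set 'rV[R]_n) (psi : 'rV[R]_n -> R) (B : R),
  [/\ open V, nbhs a W, 0 <= B, class_C k.+1 V psi &
      (forall y, V y -> [/\ U (ins i (psi y) y), w (ins i (psi y) y) = 0,
          pd i w (ins i (psi y) y) != 0 & forall j,
          pd j psi y = - pd (lift i j) w (ins i (psi y) y) / pd i w (ins i (psi y) y)
          /\ `|pd j psi y| <= B]) /\
      (forall x, W x -> w x = 0 -> V (del i x) /\ x = ins i (psi (del i x)) (del i x))].
  have [dw0|] := ltP 0 (pd i w a); first exact: implicit_graph_pos.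
  rewrite le_eqVlt (negbTE dwa) /= => dw0.
  have dw x : U x -> differentiable w x.
    by move=> Ux; exact: class_C_differentiable wC Ux.
  have [||W [V [psi [B [oV Wa B0 psiC [graph inv]]]]]] :=
    implicit_graph_pos (i := i) oU Ua (class_C_N oU wC).
  - by rewrite wa oppr0.
  - by rewrite pdN ?oppr_gt0 //; exact: dw.
  exists W, V, psi, B; split=> //; split=> [y /graph[Uy /eqP]|x /inv h wx].
    rewrite oppr_eq0 pdN ?oppr_eq0; last exact: dw.
    move=> /eqP wy dwy h; split=> // j.
    have [] := h j; rewrite !pdN; try exact: dw.
    by rewrite invrN mulrNN mulNr.
  by apply: h; rewrite wx oppr0.
pose Psi y := ins i (psi y) y.
have PsiC j : class_C k.+1 V (fun y => Psi y 0 j).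
  case: (unliftP i j) => [l ->|->].
    by apply: class_C_ext (class_C_coord k.+1 V l) => // y _; rewrite ins_lift.
  by apply: class_C_ext psiC => // y _; rewrite ins_i.
have psiE : (fun y => Psi y 0 i) = psi by apply/funext => y; exact: ins_i.
exists W, V, Psi, B; split=> //; split.
- by move=> y /graph[].
- by move=> y l; exact: ins_lift.
- move=> f y l Vy df; rewrite /pd derive_comp //; last first.
    by apply: differentiable_row => j; exact: class_C_differentiable (PsiC j) Vy.
  rewrite (sum_lift i) (bigD1 l) //= psiE big1 ?addr0 => [|p pl].
    rewrite (_ : (fun z => Psi z 0 (lift i l)) = fun z => z 0 l); last first.
      by apply/funext => z; rewrite ins_lift.
    rewrite -/(pd l (fun z => z 0 l) y) pd_coord eqxx mulr1 addrC; congr (_ + _).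
    have [_ _ _ /(_ l)[dE _]] := graph y Vy.
    by rewrite -[X in _ * X]/(pd l psi y) dE mulNr mulrN [in LHS]mulrC.
  rewrite (_ : (fun z => Psi z 0 (lift i p)) = fun z => z 0 p); last first.
    by apply/funext => z; rewrite ins_lift.
  by rewrite -/(pd l (fun z => z 0 p) y) pd_coord eq_sym (negbTE pl) mulr0.
- by move=> y l Vy; rewrite psiE; have [_ _ _ /(_ l)[]] := graph y Vy.
- by move=> x Wx wx; have [Vx E] := inv x Wx wx; split=> //; rewrite /Psi -E.
Qed.

End ImplicitGraph.

(** * Null sets *)

Section NullSets.
Context {R : realType}.

Lemma box_volume_ge0 n (a b : 'rV[R]_n) :
  (forall i, a 0 i <= b 0 i) -> 0 <= box_volume a b.
Proof. by move=> ab; apply: prodr_ge0 => i _; rewrite subr_ge0. Qed.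

Lemma lebesgue_outer_ge0 n (A : set 'rV[R]_n) : (0 <= lebesgue_outer_measure A)%E.
Proof.
apply: le_ereal_inf_tmp => _ [D [a [b [ab _ ->]]]].
by apply: nneseries_ge0 => k _ _; rewrite lee_fin box_volume_ge0.
Qed.

Lemma lebesgue_null_le n (A : set 'rV[R]_n) :
  (forall e : R, 0 < e -> (lebesgue_outer_measure A <= e%:E)%E) -> lebesgue_null A.
Proof.
move=> Ae; apply/eqP; rewrite eq_le lebesgue_outer_ge0 andbT.
by apply/lee_addgt0Pr => e e0; rewrite add0e; exact: Ae.
Qed.

(** The cover is reindexed by [pickle]: [D] selects the image of [S], and [ext] puts a degenerate
    box at 0 elsewhere. *)
Lemma outer_le_cover n (A : set 'rV[R]_n) (J : countType) (S : set J)
    (a b : J -> 'rV[R]_n) :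
  (forall j, S j -> forall i, a j 0 i <= b j 0 i) ->
  A `<=` \bigcup_(j in S) box (a j) (b j) ->
  (lebesgue_outer_measure A <= \esum_(j in S) (box_volume (a j) (b j))%:E)%E.
Proof.
move=> ab Acov.
pose D k := `[< (pickle @` S) k >].
pose ext (c : J -> 'rV[R]_n) k :=
  if unpickle k is Some j then if `[< S j >] then c j else 0 else 0.
have extE c j : S j -> ext c (pickle j) = c j.
  by move=> Sj; rewrite /ext pickleK; case: asboolP.
have extab k i : ext a k 0 i <= ext b k 0 i.
  by rewrite /ext; case: unpickle => [j|] //; case: asboolP => // Sj; exact: ab.
apply: ereal_inf_lbound; exists D, (ext a), (ext b); split=> //.
  move=> x /Acov[j Sj bj]; exists (pickle j); last by rewrite !extE.
  by apply/asboolP; exists j.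
rewrite nneseries_esum => [|k _]; last by rewrite lee_fin box_volume_ge0.
have -> : [set k | D k] = pickle @` S.
  by apply/seteqP; split=> k /=; [move/asboolP|move=> ?; apply/asboolP].
rewrite esum_image; last by move=> j1 j2 _ _; exact: (pcan_inj pickleK).
by apply: eq_esum => j Sj; rewrite !extE.
Qed.

Lemma lebesgue_null_sub n (A B : set 'rV[R]_n) :
  A `<=` B -> lebesgue_null B -> lebesgue_null A.
Proof.
move=> AB B0; apply/eqP; rewrite eq_le lebesgue_outer_ge0 andbT -B0.
apply: ereal_inf_le_tmp => v [D [a [b [ab Bcov vE]]]].
by exists D, a, b; split=> //; exact: subset_trans Bcov.
Qed.

Lemma outer_le_finite_cover n (A : set 'rV[R]_n) (J : finType) (P : pred J)
    (a b : J -> 'rV[R]_n) :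
  (forall j, P j -> forall i, a j 0 i <= b j 0 i) ->
  (forall x, A x -> exists2 j, P j & box (a j) (b j) x) ->
  (lebesgue_outer_measure A <= (\sum_(j | P j) box_volume (a j) (b j))%:E)%E.
Proof.
move=> ab Acov.
have := @outer_le_cover n A J [set j | P j] a b ab.
move/(_ _)/le_trans; apply.
  by move=> x /Acov[j Pj bj]; exists j.
have finP : finite_set [set j | P j] by exact: finite_finset.
rewrite -sumEFin esum_fset //; last first.
  by move=> j; rewrite inE => /= Pj; rewrite lee_fin box_volume_ge0 //; exact: ab.
rewrite -big_enum [leRHS]fsbig_seq ?enum_uniq //.
suff -> : [set` enum P] = [set j | P j] by [].
by apply/seteqP; split=> j /=; rewrite mem_enum.
Qed.

Lemma lebesgue_null0 n : lebesgue_null (set0 : set 'rV[R]_n).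
Proof.
apply: lebesgue_null_le => e e0.
apply: (le_trans (@outer_le_finite_cover n set0 'I_0 predT (fun _ => 0) (fun _ => 0) _ _)) => //.
by rewrite big_ord0 lee_fin ltW.
Qed.

Lemma lebesgue_null_bigcup n (A : nat -> set 'rV[R]_n) :
  (forall k, lebesgue_null (A k)) -> lebesgue_null (\bigcup_k A k).
Proof.
move=> A0; apply: lebesgue_null_le => e e0.
have cov k : exists c : pred nat * (nat -> 'rV[R]_n) * (nat -> 'rV[R]_n),
    [/\ forall l i, c.1.2 l 0 i <= c.2 l 0 i,
      A k `<=` \bigcup_(l in [set l | c.1.1 l]) box (c.1.2 l) (c.2 l) &
      (\sum_(0 <= l <oo | c.1.1 l) (box_volume (c.1.2 l) (c.2 l))%:E
        <= (e / (2 ^ k.+1)%:R)%:E)%E].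
  have ek : (lebesgue_outer_measure (A k) < (e / (2 ^ k.+1)%:R)%:E)%E.
    by rewrite (A0 k) lte_fin divr_gt0 // ltr0n expn_gt0.
  have [v [D [a [b [ab Acov ->]]]] ve] := ereal_inf_lt ek.
  by exists (D, a, b); split=> //; exact: ltW.
have [c cP] := choice cov.
pose S := [set kl : nat * nat | (c kl.1).1.1 kl.2].
have SE : S = setT `*`` (fun k => [set l | (c k).1.1 l]).
  by apply/seteqP; split=> -[k l] /=; rewrite /S /= => *; tauto.
apply: le_trans (@outer_le_cover n _ _ S (fun kl => (c kl.1).1.2 kl.2)
  (fun kl => (c kl.1).2 kl.2) _ _) _.
- by move=> -[k l] _; have [ab _ _] := cP k; exact: ab.
- move=> x [k _ Akx]; have [_ Acov _] := cP k.
  by have [l Dl bl] := Acov _ Akx; exists (k, l).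
rewrite SE -(@esum_esum _ _ _ setT (fun k => [set l | (c k).1.1 l])
  (fun k l => (box_volume ((c k).1.2 l) ((c k).2 l))%:E)); last first.
  by move=> k l _ _; rewrite lee_fin box_volume_ge0 //; case: (cP k).
apply: le_trans (epsilon_trick0 xpredT (ltW e0)).
rewrite nneseries_esumT => [|k]; last by rewrite lee_fin divr_ge0 // ltW.
apply: le_esum => k _; have [ab _ ke] := cP k.
by rewrite -nneseries_esum // => l _; rewrite lee_fin box_volume_ge0.
Qed.

Lemma lebesgue_null_count n (J : countType) (A : J -> set 'rV[R]_n) :
  (forall j, lebesgue_null (A j)) -> lebesgue_null (\bigcup_j A j).
Proof.
move=> A0; pose B k := if unpickle k is Some j then A j else set0.
have : lebesgue_null (\bigcup_k B k).
  apply: lebesgue_null_bigcup => k; rewrite /B; case: unpickle => [j|] //.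
  exact: lebesgue_null0.
apply: lebesgue_null_sub => x [j _ Ajx]; exists (pickle j) => //.
by rewrite /B pickleK.
Qed.

Lemma lebesgue_nullU n (A B : set 'rV[R]_n) :
  lebesgue_null A -> lebesgue_null B -> lebesgue_null (A `|` B).
Proof.
move=> A0 B0; have : lebesgue_null (\bigcup_(b in [set: bool]) if b then A else B).
  by apply: lebesgue_null_count => -[].
by apply: lebesgue_null_sub => x [Ax|Bx]; [exists true|exists false].
Qed.

(** A Lindelof argument: among the countably many balls with rational centre and radius 1/(k+1),
    those where the image of [A] is null already cover [A]. *)
Lemma lebesgue_null_local m n (A : set 'rV[R]_m) (T : 'rV[R]_m -> 'rV[R]_n) :
  (forall a, A a -> exists2 W, nbhs a W & lebesgue_null (T @` (A `&` W))) ->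
  lebesgue_null (T @` A).
Proof.
move=> Aloc.
pose ctr (q : 'rV[rat]_m) : 'rV[R]_m := map_mx ratr q.
pose N (qk : 'rV[rat]_m * nat) := ball (ctr qk.1) (qk.2.+1%:R^-1 : R).
pose S qk := if `[< lebesgue_null (T @` (A `&` N qk)) >] then T @` (A `&` N qk) else set0.
have NE q k : N (q, k) = ball (ctr q) (k.+1%:R^-1 : R) by [].
have : lebesgue_null (\bigcup_qk S qk).
  apply: lebesgue_null_count => qk; rewrite /S; case: asboolP => // _.
  exact: lebesgue_null0.
apply: lebesgue_null_sub => _ [a Aa <-].
have [W /nbhs_ballP[e /= e0 aW] W0] := Aloc a Aa.
pose k := Num.truncn (2 / e).
have k0 : 0 < (k.+1%:R^-1 : R) by rewrite invr_gt0 ltr0n.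
(* A ball of this radius that contains [a] then lies in the ball of radius [e] about [a], hence in
   [W]. *)
have ke : (k.+1%:R^-1 : R) < e / 2.
  rewrite -[e / 2]invrK ltf_pV2 ?posrE ?invr_gt0 ?divr_gt0 ?ltr0n // invf_div.
  exact: truncnS_gt.
move: NE k0 ke => /(_ _ k); set d : R := k.+1%:R^-1 => NE k0 ke.
have qP i : exists q : rat, `|a 0 i - ratr q| < d.
  have [|q] := @rat_in_itvoo R (a 0 i - d) (a 0 i + d).
    by by lra.
  rewrite in_itv /= => /andP[h1 h2]; exists q.
  by rewrite ltr_norml; apply/andP; split; lra.
have [q qP'] := choice qP.
exists (\row_i q i, k) => //.
have Na : N (\row_i q i, k) a by rewrite NE; apply/rV_ballP => // i; rewrite !mxE.
have NW : N (\row_i q i, k) `<=` W.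
  rewrite NE => x /(rV_ballP _ _ k0) xq; apply/aW/rV_ballP => // i.
  have := xq i; have := qP' i; rewrite !mxE !ltr_norml => /andP[h1 h2] /andP[h3 h4].
  by apply/andP; split; lra.
rewrite /S; case: asboolP => [_|[]]; first by exists a.
apply: lebesgue_null_sub W0 => _ [x [Ax Nx] <-]; exists x => //.
by split=> //; exact: NW.
Qed.

End NullSets.

(** * Flat maps *)

Section Flat.
Context {R : realType}.

(* A grid with [K] steps in the coordinates marked by [b] and [K ^ q] steps in
   the others has [K ^ weight b q] cells. *)
Definition weight M (b : pred 'I_M) (q : nat) : nat :=
  (\sum_i (if b i then 1 else q))%N.

(* [b] marks the fibre coordinates, the only ones that move along the curve. *)
Definition fiber_curve M (b : pred 'I_M) (V : set 'rV[R]_M) (gam : R -> 'rV[R]_M)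
    (L : R) :=
  forall t : R, 0 <= t <= 1 -> [/\ V (gam t), differentiable gam t &
    forall i, `|'D_1 (fun u => gam u 0 i) t| <= if b i then L else 0].

(* The fibre variation of [T] from points of [A] is bounded by [L ^+ j] times
   the supremum of [g].  Stating this along arbitrary curves makes it stable
   under composition with the graph maps of [implicit_graph], whatever their
   smoothness. *)
Definition flat M n (b : pred 'I_M) (V A : set 'rV[R]_M) (T : 'rV[R]_M -> 'rV[R]_n)
    (I : finType) (g : I -> 'rV[R]_M -> R) (j : nat) :=
  exists2 C : R, 0 <= C & forall (L B : R) gam, 0 <= L -> 0 <= B ->
    fiber_curve b V gam L -> A (gam 0) ->
    (forall t l, 0 <= t <= 1 -> `|g l (gam t)| <= B) ->
    forall q, `|T (gam 1) 0 q - T (gam 0) 0 q| <= C * L ^+ j * B.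

(** Coordinates outside the fibre have zero speed, so only fibre derivatives enter the mean value
    formula. *)
Lemma fiber_curve_bound M (b : pred 'I_M) (V : set 'rV[R]_M) gam (L B : R)
    (f : 'rV[R]_M -> R) t :
  0 <= L -> 0 <= B -> 0 <= t <= 1 -> fiber_curve b V gam L ->
  (forall x, V x -> differentiable f x) ->
  (forall s i, 0 <= s <= 1 -> b i -> `|pd i f (gam s)| <= B) ->
  `|f (gam t) - f (gam 0)| <= M%:R * (B * L).
Proof.
move=> L0 B0 /andP[t0 t1] cg df fB.
have st1 s : 0 <= s <= t -> 0 <= s <= 1.
  by move=> /andP[-> /le_trans]; apply.
have [|s /st1 s1 ->] := @curve_mean_value _ _ f gam t t0.
  by move=> s /st1 /cg[Vs dg _]; split=> //; exact: df.
rewrite normrM (ger0_norm t0) -[leRHS]mulr1 ler_pM //.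
apply: le_trans (ler_norm_sum _ _ _) _.
apply: (@le_trans _ _ (\sum_(i < M) B * L)); last first.
  by rewrite sumr_const card_ord mulr_natl.
apply: ler_sum => i _; rewrite normrM; have [_ _ /(_ i)] := cg s s1.
case: ifPn => [bi dL|_]; first by apply: ler_pM => //; exact: fB.
rewrite normr_le0 => /eqP ->; rewrite normr0 mulr0.
exact: mulr_ge0.
Qed.

Lemma fiber_curve_seg M (b : pred 'I_M) (V : set 'rV[R]_M) (x y : 'rV[R]_M) (L : R) :
  (forall t : R, 0 <= t <= 1 -> V (seg x y t)) ->
  (forall i, `|y 0 i - x 0 i| <= if b i then L else 0) ->
  fiber_curve b V (seg x y) L.
Proof.
move=> Vs xyL t t01; split; [exact: Vs|exact: differentiable_seg|move=> i].
by rewrite derive_seg.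
Qed.

Lemma seg0 M (x y : 'rV[R]_M) : seg x y 0 = x.
Proof. by rewrite /seg scale0r addr0. Qed.

Lemma seg1 M (x y : 'rV[R]_M) : seg x y 1 = y.
Proof. by rewrite /seg scale1r subrKC. Qed.

Lemma card_ord_lt S N : (N <= S)%N -> #|[pred t : 'I_S | (t < N)%N]| = N.
Proof.
move=> NS; rewrite -sum1_card -[RHS]card_ord -sum1_card.
by rewrite (big_ord_widen _ (fun=> 1%N) NS).
Qed.

(** The cell index is the integer part of the rescaled coordinate. [S] bounds the step counts so
    that one finite type serves all directions. *)
Lemma ball_grid M (a : 'rV[R]_M) (rho : R) (N : 'I_M -> nat) S x i :
  0 < rho -> (0 < N i <= S)%N -> ball a rho x ->
  exists2 t : 'I_S, (t < N i)%N &
   a 0 i - rho + 2 * rho * t%:R / (N i)%:R <= x 0 i <=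
   a 0 i - rho + 2 * rho * t%:R / (N i)%:R + 2 * rho / (N i)%:R.
Proof.
move=> rho0 /andP[Ni0 NS] /(rV_ballP _ _ rho0) /(_ i).
rewrite ltr_norml => /andP[h1 h2].
have N0 : 0 < (N i)%:R :> R by rewrite ltr0n.
set y := (x 0 i - a 0 i + rho) * (N i)%:R / (2 * rho).
have y0 : 0 <= y by rewrite divr_ge0 ?mulr_ge0 //; lra.
have yN : y < (N i)%:R.
  by rewrite ltr_pdivrMr ?mulr_gt0 // mulrC ltr_pM2l //; lra.
have [ty yt] : (Num.truncn y)%:R <= y /\ y < (Num.truncn y).+1%:R.
  by have /andP[] := truncn_itv y0.
have tN : (Num.truncn y < N i)%N by rewrite -(ltr_nat R) (le_lt_trans ty).
exists (Ordinal (leq_trans tN NS)) => //=.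
have xE : x 0 i = a 0 i - rho + 2 * rho * y / (N i)%:R.
  by rewrite /y; field; rewrite ?gt_eqF.
have u0 : 0 <= 2 * rho / (N i)%:R by rewrite divr_ge0 ?mulr_ge0 ?(ltW rho0) ?(ltW N0).
rewrite {}xE ![2 * rho * _ / _]mulrAC.
have yt' : y <= (Num.truncn y)%:R + 1 by rewrite natr1 ltW.
have := ler_wpM2l u0 ty; have := ler_wpM2l u0 yt'.
by rewrite mulrDr mulr1 => ? ?; apply/andP; split; lra.
Qed.

(** There are [K ^ weight b j] cells, and the part of [A] in each has its image in a box of volume
    [(2 * D) ^ n / K ^ (j * n)]; the strict inequality leaves a factor 1/K. *)
Lemma flat_null M n (b : pred 'I_M) (V A : set 'rV[R]_M)
    (T : 'rV[R]_M -> 'rV[R]_n) (I : finType) (g : I -> 'rV[R]_M -> R) (j : nat) :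
  open V -> A `<=` V -> (forall q, class_C 1 V (fun x => T x 0 q)) ->
  (forall l, class_C 0 V (g l)) -> flat b V A T g j ->
  (weight b j < j * n)%N -> lebesgue_null (T @` A).
Proof.
move=> oV AV TC gC [C C0 flatT] wj; apply: lebesgue_null_local => a Aa.
have Va := AV a Aa.
have near_g : exists2 B : R, 0 <= B & \forall x \near a, forall l, `|g l x| <= B.
  exists (\sum_l `|g l a| + 1); first by rewrite addr_ge0 // sumr_ge0.
  apply: (@filter_forall _ _ (fun l x => `|g l x| <= _) (nbhs a)) => l.
  have /cvgrPdist_le/(_ 1 ltr01) := gC l a Va; apply: filterS => x /= h.
  rewrite -(subrK (g l a) (g l x)) (le_trans (ler_normD _ _)) // addrC lerD //.
    by rewrite (bigD1 l) //= lerDl sumr_ge0.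
  by rewrite distrC.
have [Bg Bg0 ngB] := near_g.
have near_T : exists2 B : R, 0 <= B & \forall x \near a,
    forall q, V x /\ forall i, `|pd i (fun y => T y 0 q) x| <= B.
  have /choice[B BP] q : exists B : R, 0 <= B /\ \forall x \near a,
      V x /\ forall i, `|pd i (fun y => T y 0 q) x| <= B.
    by have [B B0 nB] := near_pd_bounded oV Va (TC q); exists B.
  exists (\sum_q B q); first by apply: sumr_ge0 => q _; case: (BP q).
  apply: (@filter_forall _ _ (fun q x => V x /\ forall i, _ <= _) (nbhs a)) => q.
  have [_] := BP q; apply: filterS => x [Vx xB]; split=> // i.
  rewrite (le_trans (xB i)) // (bigD1 q) //= lerDl.
  by apply: sumr_ge0 => p _; case: (BP p).
have [B B0 nTB] := near_T.
have nV : \forall x \near a, V x by apply: open_nbhs_nbhs.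
have [rho rho0 box] := nbhs_box (filterI nV (filterI ngB nTB)).
pose inbox (x : 'rV[R]_M) := forall i, `|x 0 i - a 0 i| <= rho.
have ball_inbox x : ball a rho x -> inbox x.
  by move=> /(rV_ballP _ _ rho0) h i; exact: ltW.
exists (ball a rho); first exact: nbhsx_ballx.
(* The first term comes from flatness along the fibre, the second from the bounded derivatives of
   [T] along the other coordinates. *)
pose D := C * (2 * rho) ^+ j * Bg + M%:R * (B * (2 * rho)).
have r20 : 0 <= 2 * rho by rewrite mulr_ge0 // ltW.
have D0 : 0 <= D.
  apply: addr_ge0; apply: mulr_ge0 => //; last exact: mulr_ge0.
  by apply: mulr_ge0 => //; exact: exprn_ge0.
have diam (K : nat) x c : (0 < K)%N -> A x -> ball a rho x -> ball a rho c ->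
    (forall i, `|c 0 i - x 0 i| <= 2 * rho / (K ^ (if b i then 1 else j))%N%:R) ->
    forall q, `|T c 0 q - T x 0 q| <= D / (K ^ j)%N%:R.
  move=> K0 Ax /ball_inbox bx /ball_inbox bc xc q.
  have KR : 0 < K%:R :> R by rewrite ltr0n.
  (* From [x] to [z] only fibre coordinates move, starting in [A] as flatness requires; from [z] to
     [c] only the others move. *)
  pose z : 'rV[R]_M := \row_i (if b i then c 0 i else x 0 i).
  have bz : inbox z by move=> i; rewrite mxE; case: ifP.
  have h1 : `|T z 0 q - T x 0 q| <= C * (2 * rho / K%:R) ^+ j * Bg.
    have cz : fiber_curve b V (seg x z) (2 * rho / K%:R).
      apply: fiber_curve_seg => [t t01|i]; first by case: (box _ (seg_box t01 bx bz)).
      rewrite mxE; have := xc i; case: ifP => _; last by rewrite subrr normr0.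
      by rewrite expn1.
    have := flatT _ Bg _ _ Bg0 cz; rewrite seg0 seg1; apply=> //.
      by rewrite divr_ge0.
    by move=> t l t01; have [_ [gB _]] := box _ (seg_box t01 bx bz).
  have h2 : `|T c 0 q - T z 0 q| <= M%:R * (B * (2 * rho / (K ^ j)%N%:R)).
    have cz : fiber_curve (predC b) V (seg z c) (2 * rho / (K ^ j)%N%:R).
      apply: fiber_curve_seg => [t t01|i]; first by case: (box _ (seg_box t01 bz bc)).
      by rewrite mxE /=; have := xc i; case: ifP => //= _; rewrite subrr normr0.
    have := @fiber_curve_bound _ _ _ _ _ B (fun x => T x 0 q) 1 _ B0 _ cz.
    rewrite seg0 seg1; apply=> //.
    - by rewrite divr_ge0.
    - by rewrite ler01 lexx.
    - by move=> y Vy; exact: class_C_differentiable (TC q) Vy.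
    - by move=> s i s01 _; have [_ [_ /(_ q)[_]]] := box _ (seg_box s01 bz bc).
  rewrite -(subrK (T z 0 q) (T c 0 q)) -addrA (le_trans (ler_normD _ _)) //.
  apply: le_trans (lerD h2 h1) _; rewrite addrC natrX.
  rewrite le_eqVlt; apply/orP; left; apply/eqP.
  by rewrite /D expr_div_n; field; rewrite expf_neq0 // gt_eqF.
apply: lebesgue_null_le => e e0.
pose E := (2 * D) ^+ n.
have E0 : 0 <= E by rewrite exprn_ge0 // mulr_ge0.
pose K := (Num.truncn (E / e)).+1.
have K0 : (0 < K)%N by [].
have KR : 0 < K%:R :> R by rewrite ltr0n.
have KE : E / K%:R <= e.
  by rewrite ler_pdivrMr // mulrC -ler_pdivrMr // ltW // truncnS_gt.
pose N i := (K ^ (if b i then 1 else j))%N.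
pose S := (K + K ^ j)%N.
have NS i : (0 < N i <= S)%N.
  rewrite expn_gt0 K0 /= /N /S; case: (b i); first by rewrite expn1 leq_addr.
  exact: leq_addl.
pose F i := [pred t : 'I_S | (t < N i)%N].
pose cell (f : {ffun 'I_M -> 'I_S}) : set 'rV[R]_M := [set x | forall i,
   a 0 i - rho + 2 * rho * (f i)%:R / (N i)%:R <= x 0 i <=
   a 0 i - rho + 2 * rho * (f i)%:R / (N i)%:R + 2 * rho / (N i)%:R].
(* A point of [A] in the cell, with default [a] when there is none. *)
pose c f := xget a (A `&` ball a rho `&` cell f).
pose dev : 'rV[R]_n := const_mx (D / (K ^ j)%N%:R).
have dev0 : 0 <= D / (K ^ j)%N%:R by rewrite divr_ge0.
apply: (le_trans (@outer_le_finite_cover _ _ _ _ (mem (family F))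
  (fun f => T (c f) - dev) (fun f => T (c f) + dev) _ _)).
- by move=> f _ q; rewrite !mxE lerD2l ge0_cp.
- move=> _ [x [Ax bx] <-].
  have /choice[f fP] i : exists t : 'I_S, (t < N i)%N /\
      a 0 i - rho + 2 * rho * t%:R / (N i)%:R <= x 0 i <=
      a 0 i - rho + 2 * rho * t%:R / (N i)%:R + 2 * rho / (N i)%:R.
    by have [t tN tx] := ball_grid rho0 (NS i) bx; exists t.
  pose f' := [ffun i => f i].
  have xf : cell f' x by move=> i; rewrite ffunE; case: (fP i).
  exists f'; first by apply/familyP => i; rewrite ffunE inE; case: (fP i).
  have [[Ac bc] cf] : (A `&` ball a rho `&` cell f') (c f').
    exact: (xgetPex a (ex_intro _ x (conj (conj Ax bx) xf))).
  move=> q; have := diam K x (c f') K0 Ax bx bc _ q.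
  rewrite !mxE distrC ler_distl; apply=> i.
  have := xf i; have := cf i; rewrite -/(N i) ler_norml.
  by move=> /andP[? ?] /andP[? ?]; apply/andP; split; lra.
rewrite lee_fin.
have volE f : box_volume (T (c f) - dev) (T (c f) + dev) = E / ((K ^ j) ^ n)%N%:R.
  rewrite /box_volume (eq_bigr (fun _ => (2 * D) / (K ^ j)%N%:R)); last first.
    by move=> q _; rewrite !mxE; lra.
  by rewrite prodr_const card_ord expr_div_n -natrX.
rewrite (eq_bigr _ (fun f _ => volE f)) sumr_const.
have -> : #|family F| = (K ^ weight b j)%N.
  rewrite card_family foldrE big_image /= /weight expn_sum.
  apply: eq_bigr => i _; rewrite card_ord_lt //; by case/andP: (NS i).
rewrite -[leLHS]mulr_natr -mulrA; apply: le_trans KE; rewrite ler_wpM2l //.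
rewrite mulrC ler_pdivrMr ?ltr0n ?expn_gt0 ?K0 // ler_pdivlMl //.
by rewrite -natrM ler_nat -expnS -expnM leq_pexp2l.
Qed.

End Flat.

(** * Parametric transversality *)

Section Sard.
Context {R : realType}.

Lemma weight_lift M (b : pred 'I_M.+1) (i : 'I_M.+1) q :
  weight b q = ((if b i then 1 else q) + weight (fun l => b (lift i l)) q)%N.
Proof. exact: bigD1_ord. Qed.

(** Since [w] is zero on [A], each point of [A] in [W] lies on the graph and is recovered by [Psi]
    from its other coordinates. *)
Lemma lebesgue_null_graph M n (A W : set 'rV[R]_M.+1) (V : set 'rV[R]_M)
    (Psi : 'rV[R]_M -> 'rV[R]_M.+1) (i : 'I_M.+1) (w : 'rV[R]_M.+1 -> R)
    (T : 'rV[R]_M.+1 -> 'rV[R]_n) :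
  (forall x, A x -> w x = 0) ->
  (forall x, W x -> w x = 0 -> V (del i x) /\ Psi (del i x) = x) ->
  lebesgue_null ((T \o Psi) @` (V `&` Psi @^-1` A)) ->
  lebesgue_null (T @` (A `&` W)).
Proof.
move=> Aw inv; apply: lebesgue_null_sub => _ [x [Ax Wx] <-].
have [Vx xE] := inv x Wx (Aw x Ax).
by exists (del i x); rewrite /= ?xE //; split=> //=; rewrite /preimage /= xE.
Qed.

(* Where the fibre derivatives of [g] vanish, they replace [g] and the order of
   flatness grows by one; elsewhere some [g l] eliminates a fibre variable. *)
Lemma flat_vanishing_null n k : forall M (b : pred 'I_M) (V A : set 'rV[R]_M)
    (T : 'rV[R]_M -> 'rV[R]_n) (I : finType) (g : I -> 'rV[R]_M -> R) (j : nat),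
  open V -> A `<=` V -> (forall q, class_C 1 V (fun x => T x 0 q)) ->
  (forall l, class_C k V (g l)) -> (forall l x, A x -> g l x = 0) ->
  flat b V A T g j -> (weight b (j + k) < (j + k) * n)%N ->
  lebesgue_null (T @` A).
Proof.
elim: k => [|k IHk].
  by move=> M b V A T I g j oV AV TC gC _ flatT; rewrite addn0; exact: flat_null flatT.
(* Where all fibre derivatives of [g] vanish, the induction on [k] applies to them with [j.+1] for
   [j]; the derivatives in other directions are replaced by zero. *)
have null0 M (b : pred 'I_M) (V A : set 'rV[R]_M) (T : 'rV[R]_M -> 'rV[R]_n)
    (I : finType) (g : I -> 'rV[R]_M -> R) (j : nat) :
  open V -> A `<=` V -> (forall q, class_C 1 V (fun x => T x 0 q)) ->
  (forall l, class_C k.+1 V (g l)) -> (forall l x, A x -> g l x = 0) ->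
  flat b V A T g j -> (weight b (j + k.+1) < (j + k.+1) * n)%N ->
  lebesgue_null (T @` (A `&` [set x | forall l i, b i -> pd i (g l) x = 0])).
  move=> oV AV TC gC g0 [C C0 flatT] wj.
  pose g' (li : I * 'I_M) := if b li.2 then pd li.2 (g li.1) else fun _ => 0.
  apply: (IHk M b V _ T _ g' j.+1) => //.
  - by move=> x [/AV].
  - move=> [l i]; rewrite /g' /=; case: ifP => _; last exact: class_C_cst.
    exact: class_C_pd.
  - by move=> [l i] x [_ A0]; rewrite /g' /=; case: ifPn => // bi; exact: A0.
  - exists (C * M%:R); first by rewrite mulr_ge0.
    move=> L B gam L0 B0 cg [Ag _] gB q.
    (* The extra power of [L]: [g] is zero where the curve starts, so it is at most [M%:R * (B * L)]
       along it. *)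
    have -> : C * M%:R * L ^+ j.+1 * B = C * L ^+ j * (M%:R * (B * L)).
      by rewrite exprSr; ring.
    apply: flatT => //; first by rewrite !mulr_ge0.
    move=> t l t01; rewrite -[g l _]subr0 -(g0 l _ Ag).
    apply: fiber_curve_bound cg _ _ => //.
      by move=> x Vx; exact: class_C_differentiable (gC l) Vx.
    by move=> s i s01 bi; have := gB s (l, i) s01; rewrite /g' /= bi.
  by rewrite addSnnS.
(* Inner induction on the dimension, lowered by each elimination of a fibre variable while [k] and
   [j] stay fixed. *)
elim=> [|M IHM] b V A T I g j oV AV TC gC g0 flatT wj.
  have := null0 _ b V A T I g j oV AV TC gC g0 flatT wj.
  by apply: lebesgue_null_sub => _ [x Ax <-]; exists x => //; split=> // l [].
pose Z := [set x | forall l i, b i -> pd i (g l) x = 0].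
have -> : A = (A `&` Z) `|` (A `&` ~` Z) by rewrite -setIUr setUv setIT.
rewrite image_setU; apply: lebesgue_nullU; first exact: null0 flatT wj.
apply: lebesgue_null_local => a [Aa nZ].
have [l [i [bi dga]]] : exists l i, b i /\ pd i (g l) a != 0.
  apply: contra_notP nZ => nex l i bi; apply/eqP; apply: contra_notT nex => dga.
  by exists l, i.
have [W [Vg [Psi [B [oVg Wa B0 PsiC [graph PsiL dPsi PsiB inv]]]]]] :=
  implicit_graph oV (AV _ Aa) (gC l) (g0 l a Aa) dga.
exists W => //.
have : lebesgue_null (T @` (A `&` W)); last first.
  by apply: lebesgue_null_sub => _ [x [[Ax _] Wx] <-]; exists x.
apply: (@lebesgue_null_graph _ _ A W Vg Psi i (g l)) => //; first exact: g0.
have VgV y : Vg y -> V (Psi y) by move=> /graph[].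
have PsiC1 q : class_C 1 Vg (fun y => Psi y 0 q) by exact: class_C_le (PsiC q).
have dP y : Vg y -> differentiable Psi y.
  by move=> Vy; apply: differentiable_row => q; exact: class_C_differentiable (PsiC q) Vy.
apply: (IHM (fun l => b (lift i l)) Vg _ _ I (fun l => g l \o Psi) j) => //.
- by move=> q; apply: class_C_comp VgV PsiC1 (TC q).
- by move=> p; apply: class_C_comp VgV PsiC (gC p).
- by move=> p y [_ Ay]; exact: g0.
(* A fibre curve of speed [L] lifts to one of speed at most [(1 + M%:R * B) * L]: the inserted
   coordinate, itself a fibre coordinate, moves at speed at most [M%:R * B * L]. *)
- have [C C0 fT] := flatT; exists (C * (1 + M%:R * B) ^+ j).
    by rewrite mulr_ge0 // exprn_ge0 // addr_ge0 // mulr_ge0.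
  move=> L D gam L0 D0 cg [Vgam Agam] gD q.
  have MB0 : 0 <= M%:R * B by rewrite mulr_ge0.
  have := fT ((1 + M%:R * B) * L) D (Psi \o gam) _ D0 _ Agam gD q.
  rewrite exprMn [C * (_ * _)]mulrA; apply; first by rewrite mulr_ge0 // addr_ge0.
  move=> t t01; have [Vt dgt gL] := cg t t01; split; first exact: VgV.
    by apply: differentiable_comp => //; exact: dP.
  move=> p; case: (unliftP i p) => [s ->|->].
    have -> : (fun u => (Psi \o gam) u 0 (lift i s)) = (fun u => gam u 0 s).
      by apply/funext => u; rewrite /= PsiL.
    apply: le_trans (gL s) _; case: ifP => // _.
    by rewrite mulrDl mul1r lerDl mulr_ge0.
  rewrite bi.
  have := @derive_comp _ _ _ gam (fun y => Psi y 0 i) t 1 dgt.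
  move=> /(_ (class_C_differentiable (PsiC i) Vt)) ->.
  apply: le_trans (ler_norm_sum _ _ _) _.
  apply: (@le_trans _ _ (\sum_(s < M) B * L)); last first.
    by rewrite sumr_const card_ord mulrDl mul1r -mulrA mulr_natl lerDr.
  apply: ler_sum => s _; rewrite normrM ler_pM //; first exact: PsiB.
  by apply: le_trans (gL s) _; case: ifP.
- by move: wj; rewrite (weight_lift _ i) bi => /ltnW.
Qed.

(** Dependence of the gradients restricted to the columns in [P]. With [predT] it says that [H] is
    not a submersion at [x]; with the state columns it will express the failure of LICQ. *)
Definition row_dependent M c (P : pred 'I_M) (H : 'I_c -> 'rV[R]_M -> R) x :=
  exists2 lam : 'I_c -> R, (exists l, lam l != 0) &
    forall i, P i -> \sum_l lam l * pd i (H l) x = 0.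

(** A relation between the reduced rows extends to all rows: the coefficient of the pivot row is
    chosen to cancel column [i]. *)
Lemma row_dependent_graph M c (P : pred 'I_M.+1) (H : 'I_c.+1 -> 'rV[R]_M.+1 -> R)
    (l0 : 'I_c.+1) (i : 'I_M.+1) (Psi : 'rV[R]_M -> 'rV[R]_M.+1) y :
  pd i (H l0) (Psi y) != 0 ->
  (forall l s, pd s (H l \o Psi) y = pd (lift i s) (H l) (Psi y) -
     pd (lift i s) (H l0) (Psi y) / pd i (H l0) (Psi y) * pd i (H l) (Psi y)) ->
  row_dependent (fun s => P (lift i s)) (fun l => H (lift l0 l) \o Psi) y ->
  row_dependent P H (Psi y).
Proof.
move=> d0 dE [lam [l laml] lam0].
pose S := \sum_p lam p * pd i (H (lift l0 p)) (Psi y).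
pose mu p := if unlift l0 p is Some q then lam q else - S / pd i (H l0) (Psi y).
exists mu; first by exists (lift l0 l); rewrite /mu liftK.
have sumE s : \sum_p mu p * pd s (H p) (Psi y) =
    \sum_p lam p * pd s (H (lift l0 p)) (Psi y)
      - S / pd i (H l0) (Psi y) * pd s (H l0) (Psi y).
  rewrite (bigD1_ord l0) //= /mu unlift_none addrC mulNr; congr (_ + _).
    by apply: eq_bigr => p _; rewrite liftK.
  by rewrite mulNr.
move=> s Ps; rewrite sumE; case: (unliftP i s) Ps => [q ->|->] Ps; last first.
  by rewrite divfK // subrr.
have := lam0 q Ps; under eq_bigr do rewrite dE mulrBr; rewrite sumrB.
move=> /(fun E => etrans _ E); apply; congr (_ - _); rewrite /S !mulr_suml.
by apply: eq_bigr => p _; ring.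
Qed.

(** Column [i], available by [P i], determines the coefficient of the pivot row from the others.
    Hence the others are not all zero. *)
Lemma row_dependent_graph_inv M c (P : pred 'I_M.+1)
    (H : 'I_c.+1 -> 'rV[R]_M.+1 -> R) (l0 : 'I_c.+1) (i : 'I_M.+1)
    (Psi : 'rV[R]_M -> 'rV[R]_M.+1) y :
  P i -> pd i (H l0) (Psi y) != 0 ->
  (forall l s, pd s (H l \o Psi) y = pd (lift i s) (H l) (Psi y) -
     pd (lift i s) (H l0) (Psi y) / pd i (H l0) (Psi y) * pd i (H l) (Psi y)) ->
  row_dependent P H (Psi y) ->
  row_dependent (fun s => P (lift i s)) (fun l => H (lift l0 l) \o Psi) y.
Proof.
move=> Pi d0 dE [mu [l mul] mu0]; exists (fun p => mu (lift l0 p)).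
  apply: contraPP mul => nex; apply/negP; rewrite negbK; apply/eqP.
  have mul0 p : mu (lift l0 p) = 0.
    by apply/eqP; apply: contra_notT nex => h; exists p.
  have := mu0 i Pi; rewrite (bigD1_ord l0) //= big1 => [|p _]; last first.
    by rewrite mul0 mul0r.
  rewrite addr0 => /eqP; rewrite mulf_eq0 (negbTE d0) orbF => /eqP mu00.
  by case: (unliftP l0 l) => [p ->|->].
move=> s Ps; under eq_bigr do rewrite dE mulrBr; rewrite sumrB.
have := mu0 i Pi; have := mu0 _ Ps; rewrite !(bigD1_ord l0) //=.
move=> /eqP; rewrite addrC addr_eq0 => /eqP ->.
move=> /eqP; rewrite addrC addr_eq0 => /eqP E.
rewrite (eq_bigr (fun p => pd (lift i s) (H l0) (Psi y) / pd i (H l0) (Psi y) *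
  (mu (lift l0 p) * pd i (H (lift l0 p)) (Psi y)))) => [|p _]; last by ring.
by rewrite -mulr_sumr E; field.
Qed.

(* A non-fibre variable is eliminated by each equation, as the fibre
   derivatives of [H] are zero. *)
Lemma fiber_critical_null n r c : forall M (b : pred 'I_M) (V A : set 'rV[R]_M)
    (T : 'rV[R]_M -> 'rV[R]_n) (H : 'I_c -> 'rV[R]_M -> R),
  open V -> A `<=` V -> (forall q, class_C r.+1 V (fun x => T x 0 q)) ->
  (forall l, class_C r.+1 V (H l)) -> (forall l x, A x -> H l x = 0) ->
  (forall x, A x -> ~ row_dependent predT H x) ->
  (forall x i, A x -> b i -> (forall l, pd i (H l) x = 0) /\
     forall q, pd i (fun y => T y 0 q) x = 0) ->
  (weight b r.+1 < r.+1 * (n + c))%N -> lebesgue_null (T @` A).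
Proof.
elim: c => [|c IH] M b V A T H oV AV TC HC H0 indep crit wr.
  (* Without equations, the fibre derivatives of [T] are the functions vanishing on [A]; they bound
     its variation to first order, which is flatness with [j = 1]. *)
  pose g (iq : 'I_M * 'I_n) := if b iq.1 then pd iq.1 (fun y => T y 0 iq.2)
    else fun _ => 0.
  apply: (@flat_vanishing_null n r M b V A T _ g 1) => //.
  - by move=> q; exact: class_C_le (TC q).
  - move=> [i q]; rewrite /g /=; case: ifP => _; last exact: class_C_cst.
    exact: class_C_pd.
  - by move=> [i q] x Ax; rewrite /g /=; case: ifPn => // bi; case: (crit x i Ax bi).
  - exists M%:R => // L B gam L0 B0 cg _ gB q; rewrite expr1 -mulrA [L * B]mulrC.
    apply: (@fiber_curve_bound _ M b V gam L B (fun x => T x 0 q)) => //.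
    + by rewrite ler01 lexx.
    + by move=> x Vx; exact: class_C_differentiable (TC q) Vx.
    + by move=> s i s01 bi; have := gB s (i, q) s01; rewrite /g /= bi.
  - by move: wr; rewrite addn0.
apply: lebesgue_null_local => a Aa.
(* A zero gradient of [H ord0] would be a relation by itself. *)
have [i dia] : exists i, pd i (H ord0) a != 0.
  apply: contra_notP (indep a Aa) => nex.
  exists (fun l => (l == ord0)%:R); first by exists ord0; rewrite eqxx oner_eq0.
  move=> i _; rewrite (bigD1 ord0) //= ?eqxx mul1r big1 ?addr0 => [|l /negbTE ->].
    by apply/eqP; apply: contra_notT nex => h; exists i.
  by rewrite mul0r.
have nbi : ~~ b i by apply: contra dia => bi; apply/eqP; case: (crit a i Aa bi).
case: M b V A T H oV AV TC HC H0 indep crit wr a Aa i dia nbi => [|M] b V A T H.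
  by move=> ? ? ? ? ? ? ? ? ? ? [].
move=> oV AV TC HC H0 indep crit wr a Aa i dia nbi.
have [W [Vg [Psi [B [oVg Wa B0 PsiC [graph PsiL dPsi PsiB inv]]]]]] :=
  implicit_graph oV (AV _ Aa) (HC ord0) (H0 ord0 a Aa) dia.
exists W => //; apply: (@lebesgue_null_graph _ _ A W Vg Psi i (H ord0)) => //.
  exact: H0.
have VgV y : Vg y -> V (Psi y) by move=> /graph[].
have dH l y s : Vg y -> pd s (H l \o Psi) y = pd (lift i s) (H l) (Psi y) -
     pd (lift i s) (H ord0) (Psi y) / pd i (H ord0) (Psi y) * pd i (H l) (Psi y).
  by move=> Vy; apply: dPsi => //; exact: class_C_differentiable (HC l) (VgV _ Vy).
apply: (IH M (fun l => b (lift i l)) Vg _ _ (fun l => H (lift ord0 l) \o Psi)) => //.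
- by move=> q; apply: class_C_comp VgV PsiC (TC q).
- by move=> p; apply: class_C_comp VgV PsiC (HC _).
- by move=> p y [_ Ay]; exact: H0.
- move=> y [Vy Ay] dep; apply: (indep _ Ay).
  have [_ _ d0] := graph y Vy.
  by apply: (row_dependent_graph (l0 := ord0) d0) => [l s|]; [exact: dH|exact: dep].
- move=> y s [Vy Ay] bs; have [Hs Ts] := crit _ _ Ay bs; split=> [l|q].
    by rewrite dH // !Hs mul0r mul0r subrr.
  have := dPsi (fun y => T y 0 q) y s Vy; rewrite Hs Ts !mul0r subrr; apply.
  exact: class_C_differentiable (TC q) (VgV _ Vy).
(* A non-fibre coordinate weighs [r.+1], just what the loss of one equation takes from the right
   side. *)
- by move: wr; rewrite (weight_lift _ i) (negbTE nbi) addnS mulnS ltn_add2l.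
Qed.

Lemma weightE M (b : pred 'I_M) q : (weight b q + q * #|b| = #|b| + q * M)%N.
Proof.
rewrite /weight (bigID b) /= (eq_bigr (fun=> 1%N)) => [|i ->] //.
rewrite [in X in (_ + X + _)%N](eq_bigr (fun=> q)) => [|i /negbTE ->] //.
have cM : (#|b| + #|[pred i | ~~ b i]| = M)%N by rewrite -[RHS]card_ord -(cardC b).
rewrite sum1_card sum_nat_const -[X in (_ = _ + q * X)%N]cM -addnA mulnC -mulnDr.
by rewrite [(_ + #|b|)%N]addnC.
Qed.

(* [b] marks the variables x, the others are the parameters.  Some x_i can be
   eliminated unless the x-derivative of [H] vanishes altogether. *)
Theorem parametric_transversality_null n r e c : forall M (b : pred 'I_M)
    (V A : set 'rV[R]_M) (T : 'rV[R]_M -> 'rV[R]_n) (H : 'I_c -> 'rV[R]_M -> R),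
  open V -> A `<=` V -> (forall q, class_C r.+1 V (fun x => T x 0 q)) ->
  (forall l, class_C r.+1 V (H l)) -> (forall l x, A x -> H l x = 0) ->
  (forall x, A x -> ~ row_dependent predT H x) ->
  (forall x, A x -> row_dependent b H x) ->
  (forall x i q, A x -> b i -> pd i (fun y => T y 0 q) x = 0) ->
  (#|b| <= c + e)%N -> (M <= n + #|b|)%N -> (e < r)%N -> lebesgue_null (T @` A).
Proof.
elim: c => [|c IH] M b V A T H oV AV TC HC H0 indep dep T0 be Mn er.
  have -> : A = set0 by apply/seteqP; split=> // x /dep[lam [[]]].
  by rewrite image_set0; exact: lebesgue_null0.
pose Z := [set x | forall l i, b i -> pd i (H l) x = 0].
have -> : A = (A `&` Z) `|` (A `&` ~` Z) by rewrite -setIUr setUv setIT.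
rewrite image_setU; apply: lebesgue_nullU.
  apply: (@fiber_critical_null n r c.+1 M b V _ T H) => //.
  - by move=> x [/AV].
  - by move=> l x [Ax _]; exact: H0.
  - by move=> x [Ax _]; exact: indep.
  - by move=> x i [Ax Zx] bi; split=> [l|q]; [exact: Zx|exact: T0].
  (* The weight is at most [c.+1 + e + r.+1 * n], so [e < r * c.+1] suffices. *)
  - by have := weightE b r.+1; nia.
apply: lebesgue_null_local => a [Aa nZ].
have [l [i [bi dia]]] : exists l i, b i /\ pd i (H l) a != 0.
  apply: contra_notP nZ => nex l i bi; apply/eqP; apply: contra_notT nex => dga.
  by exists l, i.
case: M b V A T H oV AV TC HC H0 indep dep T0 be Mn Z a Aa nZ i bi dia => [|M] b V A T H.
  by move=> ? ? ? ? ? ? ? ? ? ? ? ? ? ? [].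
move=> oV AV TC HC H0 indep dep T0 be Mn Z a Aa nZ i bi dia.
have [W [Vg [Psi [B [oVg Wa B0 PsiC [graph PsiL dPsi PsiB inv]]]]]] :=
  implicit_graph oV (AV _ Aa) (HC l) (H0 l a Aa) dia.
exists W => //.
have : lebesgue_null (T @` (A `&` W)); last first.
  by apply: lebesgue_null_sub => _ [x [[Ax _] Wx] <-]; exists x.
apply: (@lebesgue_null_graph _ _ A W Vg Psi i (H l)) => //; first exact: H0.
have VgV y : Vg y -> V (Psi y) by move=> /graph[].
have dH p y s : Vg y -> pd s (H p \o Psi) y = pd (lift i s) (H p) (Psi y) -
     pd (lift i s) (H l) (Psi y) / pd i (H l) (Psi y) * pd i (H p) (Psi y).
  by move=> Vy; apply: dPsi => //; exact: class_C_differentiable (HC p) (VgV _ Vy).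
have cb : #|b| = (#|[pred s | b (lift i s)]|).+1.
  rewrite -!sum1_card big_mkcond (bigD1_ord i) //= unfold_in bi add1n.
  by rewrite -big_mkcond.
(* One equation and one marked variable disappear together, so the bounds on [#|b|] and [M] persist
   with the same [e]. *)
apply: (IH M (fun s => b (lift i s)) Vg _ _ (fun p => H (lift l p) \o Psi)) => //.
- by move=> q; apply: class_C_comp VgV PsiC (TC q).
- by move=> p; apply: class_C_comp VgV PsiC (HC _).
- by move=> p y [_ Ay]; exact: H0.
- move=> y [Vy Ay] dp; apply: (indep _ Ay).
  have [_ _ d0] := graph y Vy.
  by apply: (row_dependent_graph (l0 := l) d0) => [p s|]; [exact: dH|exact: dp].
- move=> y [Vy Ay]; have [_ _ d0] := graph y Vy.
  by apply: row_dependent_graph_inv (dep _ Ay) => // p s; exact: dH.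
- move=> y s q [Vy Ay] bs.
  have := dPsi (fun y => T y 0 q) y s Vy; rewrite !T0 // mulr0 subrr; apply.
  exact: class_C_differentiable (TC q) (VgV _ Vy).
- by move: be; rewrite cb addSn ltnS.
- by move: Mn; rewrite cb addnS ltnS.
Qed.

End Sard.

(** * Power flow equations *)

Section ComplexC.
Context {R : realType} {n : nat}.
Implicit Types (U : set 'rV[R]_n) (f g : 'rV[R]_n -> R[i]).

Definition class_C_complex k U f :=
  class_C k U (fun x => complex.Re (f x)) /\ class_C k U (fun x => complex.Im (f x)).

Lemma class_C_complex_cst k U (z : R[i]) : class_C_complex k U (fun=> z).
Proof. by split; exact: class_C_cst. Qed.

Lemma class_C_complex_M k U f g : open U ->
  class_C_complex k U f -> class_C_complex k U g ->
  class_C_complex k U (fun x => f x * g x).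
Proof.
move=> oU [fr fi] [gr gi]; split.
  have := class_C_B oU (class_C_M oU fr gr) (class_C_M oU fi gi).
  by apply: class_C_ext => // x _; case: (f x) => a b; case: (g x).
have := class_C_D oU (class_C_M oU fr gi) (class_C_M oU fi gr).
by apply: class_C_ext => // x _; case: (f x) => a b; case: (g x).
Qed.

Lemma class_C_complex_conj k U f : open U ->
  class_C_complex k U f -> class_C_complex k U (fun x => conjc (f x)).
Proof.
move=> oU [fr fi]; split.
  by apply: class_C_ext fr => // x _; case: (f x).
by apply: class_C_ext (class_C_N oU fi) => // x _; case: (f x).
Qed.

Lemma class_C_complex_D k U f g : open U ->
  class_C_complex k U f -> class_C_complex k U g ->
  class_C_complex k U (fun x => f x + g x).
Proof.
move=> oU [fr fi] [gr gi]; split.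
  have := class_C_D oU fr gr.
  by apply: class_C_ext => // x _; case: (f x) => a b; case: (g x).
have := class_C_D oU fi gi.
by apply: class_C_ext => // x _; case: (f x) => a b; case: (g x).
Qed.

Lemma class_C_complex_sum k U (I : Type) (s : seq I) (f : I -> 'rV[R]_n -> R[i]) :
  open U -> (forall i, class_C_complex k U (f i)) ->
  class_C_complex k U (fun x => \sum_(i <- s) f i x).
Proof.
move=> oU fC; elim: s => [|i s IH].
  have -> : (fun x => \sum_(i <- [::]) f i x) = (fun=> 0).
    by apply/funext => x; rewrite big_nil.
  exact: class_C_complex_cst.
have -> : (fun x => \sum_(i <- i :: s) f i x) = (fun x => f i x + \sum_(i <- s) f i x).
  by apply/funext => x; rewrite big_cons.
exact: class_C_complex_D.
Qed.

End ComplexC.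

Section PowerFlowEquations.
Context {R : realType} {N : nat}.
Implicit Types (net : network R N) (xi : 'rV[R]_(N + N)).
Implicit Types (x : 'rV[R]_(state_dim N)).

Lemma nodal_powerE net xi x k : nodal_power net xi x k 0 =
  voltage x 0 k * conjc (\sum_l nodal_admittance net xi k l * voltage x 0 l).
Proof.
rewrite /nodal_power mul_diag_mx mxE; congr (_ * _).
by rewrite mxE mxE; congr conjc; apply: eq_bigr => l _; rewrite [_^T _ _]mxE.
Qed.

(** The shunt sits on the diagonal of the admittance matrix, so it adds [u_k * conj (y_k * u_k)],
    that is [conj y_k * |u_k|^2 = (g_k - j b_k) v_k^2]. *)
Lemma nodal_power_shunt net xi x k : nodal_power net xi x k 0 =
  nodal_power net 0 x k 0 +
    ((lsubmx xi 0 k * st_v x 0 k ^+ 2) +i* (- (rsubmx xi 0 k * st_v x 0 k ^+ 2)))%C.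
Proof.
have YE l : nodal_admittance net xi k l =
    nodal_admittance net 0 k l + (if k == l then lumped_shunt xi k else 0).
  rewrite !mxE; case: ifP => _; last by rewrite addr0.
  have -> : lumped_shunt (0 : 'rV[R]_(N + N)) k = 0 by rewrite /lumped_shunt !mxE.
  by rewrite add0r addrC.
rewrite !nodal_powerE; under eq_bigr do rewrite YE mulrDl.
rewrite big_split /= rmorphD mulrDr; congr (_ + _).
rewrite (bigD1 k) //= eqxx big1 ?addr0; last first.
  by move=> l lk; rewrite eq_sym (negbTE lk) mul0r.
rewrite /lumped_shunt ![voltage _ _ _]mxE.
set c := cos _; set s := sin _.
have cs : c ^+ 2 + s ^+ 2 = 1 by exact: cos2Dsin2.
have sE : s ^+ 2 = 1 - c ^+ 2 by rewrite -cs addrC addKr.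
by simpc; apply/eqP; rewrite eq_complex /=; apply/andP; split; apply/eqP; ring: sE.
Qed.

Lemma sub_trmx_entry (u w : 'rV[R]_N) (f : R[i] -> R) (z : 'cV[R[i]]_N) k :
  (u - w - (map_mx f z)^T) 0 k = u 0 k - w 0 k - f (z k 0).
Proof. by rewrite !mxE. Qed.

Lemma power_flow_re net pL qL xi x k : power_flow net pL qL xi x 0 (lshift N k) =
  st_pG x 0 k - pL 0 k - complex.Re (nodal_power net 0 x k 0)
    - lsubmx xi 0 k * st_v x 0 k ^+ 2.
Proof.
rewrite /power_flow row_mxEl sub_trmx_entry nodal_power_shunt.
by rewrite raddfD /= opprD addrA.
Qed.

Lemma power_flow_im net pL qL xi x k : power_flow net pL qL xi x 0 (rshift N k) =
  st_qG x 0 k - qL 0 k - complex.Im (nodal_power net 0 x k 0)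
    + rsubmx xi 0 k * st_v x 0 k ^+ 2.
Proof.
rewrite /power_flow row_mxEr sub_trmx_entry nodal_power_shunt.
by rewrite raddfD /= opprD addrA opprK.
Qed.

(** The derivative of the l-th power flow equation in the l-th shunt parameter; the opposite sign in
    the reactive half comes from the conjugate. *)
Definition shunt_coef x (l : 'I_(N + N)) : R :=
  match fintype.split l with
  | inl i => - st_v x 0 i ^+ 2
  | inr i => st_v x 0 i ^+ 2
  end.

Lemma ord_addP (l : 'I_(N + N)) :
  (exists i, l = lshift N i) \/ (exists i, l = rshift N i).
Proof.
case: (splitP l) => i li; [left|right]; exists i; exact: val_inj.
Qed.

Lemma power_flow_change_shunt net pL qL xi xi' x l :
  power_flow net pL qL xi' x 0 l =
  power_flow net pL qL xi x 0 l + (xi' 0 l - xi 0 l) * shunt_coef x l.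
Proof.
case: (ord_addP l) => -[i ->]; rewrite /shunt_coef.
  have -> : fintype.split (lshift N i) = inl i by exact: (unsplitK (inl i)).
  apply: (etrans (power_flow_re _ _ _ _ _ _)); apply/esym.
  apply: (etrans (congr1 (fun t => t + _) (power_flow_re _ _ _ _ _ _))).
  have e : lsubmx xi 0 i = xi 0 (lshift N i) by rewrite mxE.
  have e' : lsubmx xi' 0 i = xi' 0 (lshift N i) by rewrite mxE.
  by rewrite e e'; ring.
have -> : fintype.split (rshift N i) = inr i by exact: (unsplitK (inr i)).
apply: (etrans (power_flow_im _ _ _ _ _ _)); apply/esym.
apply: (etrans (congr1 (fun t => t + _) (power_flow_im _ _ _ _ _ _))).
have e : rsubmx xi 0 i = xi 0 (rshift N i) by rewrite mxE.
have e' : rsubmx xi' 0 i = xi' 0 (rshift N i) by rewrite mxE.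
by rewrite e e'; ring.
Qed.

(** Voltages are read from the right half of the state, so only the generation terms, with
    coefficient one, change. *)
Lemma power_flow_change_generation net pL qL xi x x' l : rsubmx x' = rsubmx x ->
  power_flow net pL qL xi x' 0 l =
  power_flow net pL qL xi x 0 l + (lsubmx x' 0 l - lsubmx x 0 l).
Proof.
move=> xx'.
have vE : st_v x' = st_v x by rewrite /st_v xx'.
have uE : voltage x' = voltage x by rewrite /voltage vE /st_theta xx'.
have nE i : nodal_power net 0 x' i 0 = nodal_power net 0 x i 0.
  by rewrite !nodal_powerE uE.
case: (ord_addP l) => -[i ->].
  have st_pE (y : 'rV[R]_(state_dim N)) : st_pG y 0 i = lsubmx y 0 (lshift N i)
    by rewrite /st_pG [LHS]mxE.
  apply: (etrans (power_flow_re _ _ _ _ _ _)); apply/esym.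
  apply: (etrans (congr1 (fun t => t + _) (power_flow_re _ _ _ _ _ _))).
  by rewrite (nE i) vE (st_pE x) (st_pE x'); ring.
have st_qE (y : 'rV[R]_(state_dim N)) : st_qG y 0 i = lsubmx y 0 (rshift N i)
  by rewrite /st_qG [LHS]mxE.
apply: (etrans (power_flow_im _ _ _ _ _ _)); apply/esym.
  apply: (etrans (congr1 (fun t => t + _) (power_flow_im _ _ _ _ _ _))).
  by rewrite (nE i) vE (st_qE x) (st_qE x'); ring.
Qed.

End PowerFlowEquations.

(** * Partial derivatives along lines and in block coordinates *)

Section Lines.
Context {R : realType}.

(** A directional derivative depends only on the restriction to the line, so it can be transported
    between spaces. *)
Lemma derive_line (V V' W : normedModType R) (f : V -> W) (g : V' -> W) a v b w :
  (forall h : R, f (h *: v + a) = g (h *: w + b)) -> 'D_v f a = 'D_w g b.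
Proof.
move=> fg; have fab : f a = g b by have := fg 0; rewrite !scale0r !add0r.
rewrite /derive.
have -> // : (fun h : R => h^-1 *: ((f \o shift a) (h *: v) - f a)) =
    (fun h => h^-1 *: ((g \o shift b) (h *: w) - g b)).
by apply/funext => h; rewrite /= fg fab.
Qed.

Lemma derive_affine_line (V : normedModType R) (f : V -> R) a v (c : R) :
  (forall h : R, f (h *: v + a) = f a + h * c) -> 'D_v f a = c.
Proof.
move=> fc; rewrite (@derive_line V R R f (fun t => f a + t * c) a v 0 1); last first.
  by move=> h; rewrite fc addr0 /GRing.scale /= mulr1.
rewrite deriveD // derive_cst add0r deriveMr // derive_id.
by rewrite /GRing.scale /= mulr1.
Qed.

Lemma scale_delta_add n (h : R) (i j : 'I_n) (a : 'rV[R]_n) :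
  (h *: delta_mx 0 i + a : 'rV[R]_n) 0 j = a 0 j + h * (i == j)%:R.
Proof. by rewrite !mxE eqxx /= eq_sym addrC. Qed.

Context {n m : nat}.
Implicit Types z : 'rV[R]_(n + m).

Lemma rsubmx_line_l (h : R) (i : 'I_n) z :
  rsubmx (h *: delta_mx 0 (lshift m i) + z) = rsubmx z.
Proof.
apply/rowP => j; rewrite mxE scale_delta_add !mxE.
by rewrite eq_sym eq_rlshift mulr0 addr0.
Qed.

Lemma lsubmx_line_r (h : R) (i : 'I_m) z :
  lsubmx (h *: delta_mx 0 (rshift n i) + z) = lsubmx z.
Proof.
apply/rowP => j; rewrite mxE scale_delta_add !mxE.
by rewrite eq_sym eq_lrshift mulr0 addr0.
Qed.

Lemma rsubmx_line_r (h : R) (i : 'I_m) z :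
  rsubmx (h *: delta_mx 0 (rshift n i) + z) = h *: delta_mx 0 i + rsubmx z.
Proof.
apply/rowP => j; rewrite mxE !scale_delta_add !mxE.
by rewrite (inj_eq (@rshift_inj _ _)).
Qed.

Lemma lsubmx_line_l (h : R) (i : 'I_n) z :
  lsubmx (h *: delta_mx 0 (lshift m i) + z) = h *: delta_mx 0 i + lsubmx z.
Proof.
apply/rowP => j; rewrite mxE !scale_delta_add !mxE.
by rewrite (inj_eq (@lshift_inj _ _)).
Qed.

Lemma pd_rshift (f : 'rV[R]_n -> 'rV[R]_m -> R) (i : 'I_m) z :
  pd (rshift n i) (fun y : 'rV[R]_(n + m) => f (lsubmx y) (rsubmx y)) z
    = pd i (f (lsubmx z)) (rsubmx z).
Proof.
by apply: derive_line => h; rewrite lsubmx_line_r rsubmx_line_r.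
Qed.

Lemma pd_lshift_rsubmx (f : 'rV[R]_m -> R) (i : 'I_n) z :
  pd (lshift m i) (fun y : 'rV[R]_(n + m) => f (rsubmx y)) z = 0.
Proof.
by apply: derive_affine_line => h; rewrite rsubmx_line_l mulr0 addr0.
Qed.

Lemma class_C_rsubmx k (U : set 'rV[R]_m) (V : set 'rV[R]_(n + m)) (f : 'rV[R]_m -> R) :
  open V -> (forall z, V z -> U (rsubmx z)) -> class_C k U f ->
  class_C k V (fun z => f (rsubmx z)).
Proof.
move=> oV VU fC; apply: class_C_comp VU _ fC => // i.
by apply: class_C_ext (class_C_coord k V (rshift n i)) => // z _; rewrite mxE.
Qed.

Lemma open_rsubmx (U : set 'rV[R]_m) : open U ->
  open [set z : 'rV[R]_(n + m) | U (rsubmx z)].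
Proof.
move=> oU; apply: (open_comp _ oU) => z _.
exact/differentiable_continuous/differentiable_rsubmx.
Qed.

End Lines.

(** * Jacobian entries, and rank conditions as relations between rows *)

Lemma nablaE (R : realType) n m (f : 'rV[R]_n -> 'rV[R]_m) x l i :
  differentiable f x -> nabla f x l i = pd i (fun y => f y 0 l) x.
Proof.
move=> df; rewrite /nabla mxE /jacobian /lin1_mx mxE.
by rewrite /pd derive_entry // deriveE.
Qed.

Lemma row_freePn_comb (R : fieldType) m n (A : 'M[R]_(m, n)) :
  \rank A <> m -> exists2 lam : 'I_m -> R, (exists l, lam l != 0) &
    forall i, \sum_l lam l * A l i = 0.
Proof.
move=> rA; have /rowV0Pn[v /sub_kermxP vA v0] : kermx A != 0.
  by rewrite kermx_eq0; apply/negP => /eqP.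
exists (fun l => v 0 l).
  apply: contra_notP (elimN eqP v0) => nex; apply/rowP => l; rewrite mxE.
  by apply/eqP; apply: contra_notT nex => h; exists l.
by move=> i; have /rowP/(_ i) := vA; rewrite !mxE.
Qed.

Lemma row_free_comb (R : fieldType) m n (A : 'M[R]_(m, n)) (lam : 'I_m -> R) :
  \rank A = m -> (forall i, \sum_l lam l * A l i = 0) -> forall l, lam l = 0.
Proof.
move=> rA lamA l; have fA : row_free A by apply/eqP.
have : (\row_l lam l) *m A == 0.
  by apply/eqP/rowP => i; rewrite !mxE -[RHS](lamA i); apply: eq_bigr => p _; rewrite mxE.
by rewrite (mulmx_free_eq0 _ fA) => /eqP/rowP/(_ l); rewrite !mxE.
Qed.

(** * Smoothness and partial derivatives of the power flow equations in the joint space *)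

Section PowerFlowSmooth.
Context {R : realType} {N : nat} (net : network R N) (pL qL : 'rV[R]_N).
Implicit Types z : 'rV[R]_((N + N) + state_dim N).

Lemma class_C_nodal_power k (U : set 'rV[R]_(state_dim N)) l : open U ->
  class_C_complex k U (fun x => nodal_power net 0 x l 0).
Proof.
move=> oU.
have vC i : class_C_complex k U (fun x => voltage x 0 i).
  have vi : class_C k U (fun x => st_v x 0 i).
    by apply: class_C_ext (class_C_coord k U (rshift _ (lshift _ i))) => // x _; rewrite !mxE.
  have ti : class_C k U (fun x => st_theta x 0 i).
    by apply: class_C_ext (class_C_coord k U (rshift _ (rshift _ i))) => // x _; rewrite !mxE.
  have [cC sC] := class_C_cos_sin oU ti; split.
    by apply: class_C_ext (class_C_M oU vi cC) => // x _; rewrite [voltage _ _ _]mxE; simpc.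
  by apply: class_C_ext (class_C_M oU vi sC) => // x _; rewrite [voltage _ _ _]mxE; simpc.
have -> : (fun x => nodal_power net 0 x l 0) = (fun x => voltage x 0 l *
    conjc (\sum_i nodal_admittance net 0 l i * voltage x 0 i)).
  by apply/funext => x; rewrite nodal_powerE.
apply: class_C_complex_M => //; apply: class_C_complex_conj => //.
apply: class_C_complex_sum => // i; apply: class_C_complex_M => //.
exact: class_C_complex_cst.
Qed.

Lemma class_C_power_flow k (V : set 'rV[R]_((N + N) + state_dim N)) l : open V ->
  class_C k V (fun z => power_flow net pL qL (lsubmx z) (rsubmx z) 0 l).
Proof.
move=> oV.
have coordC (f : 'rV[R]_((N + N) + state_dim N) -> R) j :
    (forall z, f z = z 0 j) -> class_C k V f.
  by move=> fE; apply: class_C_ext (class_C_coord k V j) => // z _.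
have vC i : class_C k V (fun z => st_v (rsubmx z) 0 i).
  by apply: (coordC _ (rshift _ (rshift _ (lshift _ i)))) => z; rewrite !mxE.
have powC i : class_C_complex k V (fun z => nodal_power net 0 (rsubmx z) i 0).
  have [re im] := class_C_nodal_power k i (@openT _).
  by split; [apply: (class_C_rsubmx _ _ re)|apply: (class_C_rsubmx _ _ im)].
case: (ord_addP l) => -[i ->].
  have pC : class_C k V (fun z => st_pG (rsubmx z) 0 i).
    by apply: (coordC _ (rshift _ (lshift _ (lshift _ i)))) => z; rewrite !mxE.
  have gC : class_C k V (fun z => lsubmx (lsubmx z) 0 i).
    by apply: (coordC _ (lshift _ (lshift _ i))) => z; rewrite !mxE.
  have := class_C_B oV (class_C_B oV (class_C_B oV pC (class_C_cst k V (pL 0 i)))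
    (powC i).1) (class_C_M oV gC (class_C_M oV (vC i) (vC i))).
  by apply: class_C_ext => // z _; rewrite power_flow_re expr2.
have qC : class_C k V (fun z => st_qG (rsubmx z) 0 i).
  by apply: (coordC _ (rshift _ (lshift _ (rshift _ i)))) => z; rewrite !mxE.
have bC : class_C k V (fun z => rsubmx (lsubmx z) 0 i).
  by apply: (coordC _ (lshift _ (rshift _ i))) => z; rewrite !mxE.
have := class_C_D oV (class_C_B oV (class_C_B oV qC (class_C_cst k V (qL 0 i)))
  (powC i).2) (class_C_M oV bC (class_C_M oV (vC i) (vC i))).
by apply: class_C_ext => // z _; rewrite power_flow_im expr2.
Qed.

Lemma differentiable_power_flow xi x :
  differentiable (power_flow net pL qL xi) x.
Proof.
apply: differentiable_row => l.
have h := @class_C_power_flow 1 setT l (@openT _).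
pose emb (y : 'rV[R]_(state_dim N)) : 'rV[R]_((N + N) + state_dim N) := row_mx xi y.
have -> : (fun y => power_flow net pL qL xi y 0 l) =
    (fun z => power_flow net pL qL (lsubmx z) (rsubmx z) 0 l) \o emb.
  by apply/funext => y; rewrite /= /emb row_mxKl row_mxKr.
apply: differentiable_comp; last exact: class_C_differentiable h I.
apply: differentiable_row => i; case: (splitP i) => j ij.
  have -> : i = lshift _ j by exact: val_inj.
  have -> : (fun y => emb y 0 (lshift _ j)) = fun _ => xi 0 j.
    by apply/funext => y; rewrite /emb row_mxEl.
  exact: differentiable_cst.
have -> : i = rshift _ j by exact: val_inj.
have -> : (fun y => emb y 0 (rshift _ j)) = fun y => y 0 j.
  by apply/funext => y; rewrite /emb row_mxEr.
exact: differentiable_coord.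
Qed.

Lemma pd_power_flow_shunt (l k : 'I_(N + N)) z :
  pd (lshift _ k) (fun z => power_flow net pL qL (lsubmx z) (rsubmx z) 0 l) z =
  (k == l)%:R * shunt_coef (rsubmx z) l.
Proof.
apply: derive_affine_line => h; rewrite rsubmx_line_l lsubmx_line_l.
apply: (etrans (power_flow_change_shunt net pL qL (lsubmx z) _ (rsubmx z) l)).
by apply: congr1; rewrite scale_delta_add; ring.
Qed.

Lemma pd_power_flow_generation (l k : 'I_(N + N)) z :
  pd (rshift (N + N) (lshift (N + N) k))
    (fun z => power_flow net pL qL (lsubmx z) (rsubmx z) 0 l) z = (k == l)%:R.
Proof.
apply: derive_affine_line => h; rewrite rsubmx_line_r lsubmx_line_r.
apply: (etrans (power_flow_change_generation net pL qL _ l (rsubmx_line_l h k (rsubmx z)))).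
by apply: congr1; rewrite lsubmx_line_l scale_delta_add; ring.
Qed.

End PowerFlowSmooth.

(** * LICQ for almost every shunt *)

Section Application.
Context {R : realType} {N nI nJ : nat} (P : acopf R N nI nJ).
Implicit Types (S : {set 'I_nJ}) (z : 'rV[R]_((N + N) + state_dim N)).

(** [S] is a parameter rather than the active set at [z], so that the number of functions is
    constant. Their order is that of the rows in [LICQ]. *)
Definition joint_constraints S (l : 'I_((N + N) + (nI + #|S|))) z : R :=
  match fintype.split l with
  | inl k => opf_pf P (lsubmx z) (rsubmx z) 0 k
  | inr l' => match fintype.split l' with
    | inl a => opf_h P (rsubmx z) 0 a
    | inr s => g_sub P S (rsubmx z) 0 s
    end
  end.

Lemma joint_constraints_pf S k :
  joint_constraints (lshift (nI + #|S|) k) = fun z => opf_pf P (lsubmx z) (rsubmx z) 0 k.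
Proof.
by apply/funext => z; rewrite /joint_constraints (unsplitK (inl k) : fintype.split (lshift _ k) = _).
Qed.

Lemma joint_constraints_h S a :
  joint_constraints (rshift (N + N) (lshift #|S| a)) = fun z => opf_h P (rsubmx z) 0 a.
Proof.
apply/funext => z; rewrite /joint_constraints.
rewrite (unsplitK (inr (lshift #|S| a)) : fintype.split (rshift _ _) = _).
by rewrite (unsplitK (inl a) : fintype.split (lshift _ a) = _).
Qed.

Lemma joint_constraints_g S s :
  joint_constraints (rshift (N + N) (rshift nI s)) = fun z => g_sub P S (rsubmx z) 0 s.
Proof.
apply/funext => z; rewrite /joint_constraints.
rewrite (unsplitK (inr (rshift nI s)) : fintype.split (rshift _ _) = _).
by rewrite (unsplitK (inr s) : fintype.split (rshift _ s) = _).
Qed.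

Definition state_coord (i : 'I_((N + N) + state_dim N)) : bool :=
  if fintype.split i is inr _ then true else false.

Lemma state_coord_r i : state_coord (rshift (N + N) i).
Proof. by rewrite /state_coord (unsplitK (inr i) : fintype.split (rshift _ _) = _). Qed.

Lemma state_coordP i : state_coord i -> exists i', i = rshift (N + N) i'.
Proof.
rewrite /state_coord; case: (splitP i) => // i' ii' _.
by exists i'; exact: val_inj.
Qed.

Lemma card_state_coord : #|state_coord| = (state_dim N)%N.
Proof.
rewrite -sum1_card big_mkcond big_split_ord /= big1 => [|k _]; last first.
  by rewrite unfold_in /state_coord (unsplitK (inl k) : fintype.split (lshift _ k) = _).
rewrite add0n (eq_bigr (fun=> 1%N)) => [|k _]; first by rewrite sum1_card card_ord.
by rewrite (_ : rshift _ k \in state_coord) //; exact: state_coord_r.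
Qed.

Lemma pd_joint_state S (l : 'I_((N + N) + (nI + #|S|))) i z :
  differentiable (opf_h P) (rsubmx z) -> differentiable (g_sub P S) (rsubmx z) ->
  pd (rshift (N + N) i) (joint_constraints l) z =
  col_mx (nabla (opf_pf P (lsubmx z)) (rsubmx z))
    (col_mx (nabla (opf_h P) (rsubmx z)) (nabla (g_sub P S) (rsubmx z))) l i.
Proof.
move=> dh dg; case: (splitP l) => [k lk|l' ll'].
  have -> : l = lshift _ k by exact: val_inj.
  rewrite joint_constraints_pf col_mxEu nablaE; last exact: differentiable_power_flow.
  exact: (pd_rshift (fun xi x => opf_pf P xi x 0 k)).
have -> : l = rshift _ l' by exact: val_inj.
rewrite col_mxEd; case: (splitP l') => [a la|s ls].
  have -> : l' = lshift _ a by exact: val_inj.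
  rewrite joint_constraints_h col_mxEu nablaE //.
  exact: (pd_rshift (fun xi x => opf_h P x 0 a)).
have -> : l' = rshift _ s by exact: val_inj.
rewrite joint_constraints_g col_mxEd nablaE //.
exact: (pd_rshift (fun xi x => g_sub P S x 0 s)).
Qed.

Lemma differentiable_g_sub S x :
  differentiable (opf_g P) x -> differentiable (g_sub P S) x.
Proof.
move=> dg; apply: differentiable_row => s.
have -> : (fun y => g_sub P S y 0 s) = (fun y => opf_g P y 0 (enum_val s)).
  by apply/funext => y; rewrite mxE.
exact: differentiable_entry.
Qed.

Definition degenerate S : set 'rV[R]_((N + N) + state_dim N) :=
  [set z | [/\ opf_X P (rsubmx z), active P (rsubmx z) = S,
    opf_pf P (lsubmx z) (rsubmx z) = 0 & ~ LICQ P (lsubmx z) (rsubmx z)]].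

Section Degenerate.
Context (r : nat).
Hypothesis r_large : (2 * N < r)%N.
Hypothesis h_Cr : class_C_at r (opf_X P) (opf_h P).
Hypothesis g_Cr : class_C_at r (opf_X P) (opf_g P).
Hypothesis rank_X : forall x, opf_X P x -> operational_regular P x.
Hypothesis v_pos : forall x, opf_X P x -> forall k : 'I_N, 0 < st_v x 0 k.

Lemma differentiable_opf x : opf_X P x ->
  differentiable (opf_h P) x /\ differentiable (opf_g P) x.
Proof.
move=> Xx; have [Uh [_ XUh hC]] := h_Cr; have [Ug [_ XUg gC]] := g_Cr.
case: r r_large hC gC => // r' _ [dh _] [dg _].
by split; [apply/dh/XUh|apply/dg/XUg].
Qed.

Lemma pd_joint_degenerate S l i z : degenerate S z ->
  pd (rshift (N + N) i) (joint_constraints l) z =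
  col_mx (nabla (opf_pf P (lsubmx z)) (rsubmx z))
    (col_mx (nabla (opf_h P) (rsubmx z)) (nabla (g_sub P S) (rsubmx z))) l i.
Proof.
move=> [Xx _ _ _]; have [dh dg] := differentiable_opf Xx.
by apply: pd_joint_state => //; exact: differentiable_g_sub.
Qed.

Lemma joint_dependent S z : degenerate S z ->
  row_dependent state_coord (@joint_constraints S) z.
Proof.
move=> Dz; have [Xx Sx _ nlicq] := Dz.
have [|lam lam0 lamE] := @row_freePn_comb _ _ _
    (col_mx (nabla (opf_pf P (lsubmx z)) (rsubmx z))
    (col_mx (nabla (opf_h P) (rsubmx z)) (nabla (g_sub P S) (rsubmx z)))).
  by move: nlicq; rewrite /LICQ Sx => + h; apply; rewrite h; lia.
exists lam => // i /state_coordP[i' ->]; rewrite -[RHS](lamE i').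
by apply: eq_bigr => l _; rewrite pd_joint_degenerate.
Qed.

(** The shunt columns are diagonal on the power flow rows, with entries nonzero by positivity of the
    voltages, and zero on the operational rows. So the power flow coefficients vanish, and [rank_X]
    settles the others. *)
Lemma joint_independent S z : degenerate S z ->
  ~ row_dependent predT (@joint_constraints S) z.
Proof.
move=> Dz [lam [l laml] lamE]; have [Xx Sx _ _] := Dz.
have sumE i : \sum_k lam (lshift _ k) * pd i (joint_constraints (lshift (nI + #|S|) k)) z
    + \sum_q lam (rshift _ q) * pd i (joint_constraints (rshift (N + N) q)) z = 0.
  by apply: etrans (lamE i isT); rewrite [RHS]big_split_ord.
have pd0 k (q : 'I_(nI + #|S|)) : pd (lshift _ k) (joint_constraints (rshift (N + N) q)) z = 0.
  case: (splitP q) => [a qa|s qs].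
    have -> : q = lshift _ a by exact: val_inj.
    rewrite joint_constraints_h; exact: (pd_lshift_rsubmx (fun x => opf_h P x 0 a)).
  have -> : q = rshift _ s by exact: val_inj.
  rewrite joint_constraints_g; exact: (pd_lshift_rsubmx (fun x => g_sub P S x 0 s)).
have coef0 k : shunt_coef (rsubmx z) k != 0.
  rewrite /shunt_coef; case: (fintype.split k) => i; rewrite ?oppr_eq0 expf_neq0 //;
  by rewrite gt_eqF // v_pos.
have lam_pf k : lam (lshift _ k) = 0.
  have := sumE (lshift _ k); rewrite [X in _ + X]big1 => [|q _]; last by rewrite pd0 mulr0.
  rewrite addr0 (bigD1 k) //= big1 => [|k' k'k].
    rewrite addr0 joint_constraints_pf => /eqP; rewrite mulf_eq0 => /orP[/eqP//|].
    have -> := pd_power_flow_shunt (opf_net P) (opf_pL P) (opf_qL P) k k z.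
    by rewrite eqxx mul1r (negbTE (coef0 k)).
  rewrite joint_constraints_pf.
  have -> := pd_power_flow_shunt (opf_net P) (opf_pL P) (opf_qL P) k' k z.
  by rewrite eq_sym (negbTE k'k) mul0r mulr0.
have rk := rank_X Xx; rewrite /operational_regular Sx in rk.
have lam_op q : lam (rshift _ q) = 0.
  apply: (row_free_comb (lam := fun q => lam (rshift _ q)) rk) => i.
  have := sumE (rshift _ i); rewrite [X in X + _]big1 => [|k _]; last by rewrite lam_pf mul0r.
  rewrite add0r => /(fun E => etrans _ E); apply; apply: eq_bigr => p _.
  by rewrite pd_joint_degenerate // col_mxEd.
move/negP: laml; apply; apply/eqP; case: (splitP l) => [k lk|q lq].
  by have -> : l = lshift _ k by exact: val_inj.
by have -> : l = rshift _ q by exact: val_inj.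
Qed.

(** Without operational rows, the generation columns form an identity block on the power flow
    rows. *)
Lemma joint_independent_unconstrained S z : (nI + #|S|)%N = 0%N ->
  ~ row_dependent state_coord (@joint_constraints S) z.
Proof.
move=> S0 [lam [l laml] lamE].
have noq (q : 'I_(nI + #|S|)) : False by case: q => q; rewrite S0.
case: (splitP l) laml => [k lk|q]; last by case: (noq q).
have -> : l = lshift _ k by exact: val_inj.
move=> /negP; apply; apply/eqP.
have := lamE (rshift _ (lshift _ k)) (state_coord_r _); rewrite big_split_ord /=.
rewrite [X in _ + X]big1 => [|q _]; last by case: (noq q).
have pfE k' : pd (rshift (N + N) (lshift (N + N) k))
    (joint_constraints (lshift (nI + #|S|) k')) z = (k == k')%:R.
  rewrite joint_constraints_pf.
  exact: (pd_power_flow_generation (opf_net P) (opf_pL P) (opf_qL P) k' k z).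
rewrite addr0 (bigD1 k) //= pfE eqxx mulr1 big1 ?addr0 // => k' k'k.
by rewrite pfE eq_sym (negbTE k'k) mulr0.
Qed.

Lemma degenerate_null S : lebesgue_null (lsubmx @` degenerate S).
Proof.
(* This case is set apart: its excess [e = 2 * N] would have to be below [r.-1], while [r_large]
   only gives [2 * N <= r.-1]. *)
have [S0|S0] := eqVneq (nI + #|S|)%N 0%N.
  have -> : degenerate S = set0.
    apply/seteqP; split=> // z /joint_dependent; exact: joint_independent_unconstrained.
  by rewrite image_set0; exact: lebesgue_null0.
(* With [N = 0] the state space has dimension 0, where regularity contradicts the presence of an
   operational row. *)
have [N0|N0] := eqVneq N 0%N.
  have -> : degenerate S = set0; last by rewrite image_set0; exact: lebesgue_null0.
  apply/seteqP; split=> // z [Xx Sx _ _]; have := rank_X Xx.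
  rewrite /operational_regular Sx => rk.
  have := rank_leq_col (col_mx (nabla (opf_h P) (rsubmx z)) (nabla (g_sub P S) (rsubmx z))).
  by rewrite rk; lia.
have [Uh [oUh XUh hC]] := h_Cr; have [Ug [oUg XUg gC]] := g_Cr.
have r0 : r = r.-1.+1 by lia.
pose V : set 'rV[R]_((N + N) + state_dim N) := [set z | Uh (rsubmx z)] `&` [set z | Ug (rsubmx z)].
have oV : open V by apply: openI; exact: open_rsubmx.
(* [T] is the projection to the shunts. The excess of the [4 * N] state variables over the equations
   is at most [2 * N - 1] after the two cases above, hence below [r.-1]. *)
apply: (@parametric_transversality_null R (N + N) r.-1 (2 * N - (nI + #|S|))
  ((N + N) + (nI + #|S|)) _ state_coord V _ lsubmx (@joint_constraints S)) => //.
- by move=> z [Xx _ _ _]; split; [exact: XUh|exact: XUg].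
- move=> q; apply: class_C_ext (class_C_coord _ V (lshift _ q)) => // z _.
  by rewrite mxE.
- rewrite -r0 => l; case: (splitP l) => [k lk|l' ll'].
    have -> : l = lshift _ k by exact: val_inj.
    rewrite joint_constraints_pf; exact: class_C_power_flow.
  have -> : l = rshift _ l' by exact: val_inj.
  case: (splitP l') => [a la|s ls].
    have -> : l' = lshift _ a by exact: val_inj.
    rewrite joint_constraints_h.
    by apply: (class_C_rsubmx oV _ (class_C_entry a oUh hC)) => z [].
  have -> : l' = rshift _ s by exact: val_inj.
  rewrite joint_constraints_g.
  have -> : (fun z => g_sub P S (rsubmx z) 0 s) =
      (fun z => opf_g P (rsubmx z) 0 (enum_val s)).
    by apply/funext => z; rewrite mxE.
  by apply: (class_C_rsubmx oV _ (class_C_entry (enum_val s) oUg gC)) => z [].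
- move=> l z [[hx gx] Sx pf _]; case: (splitP l) => [k lk|l' ll'].
    have -> : l = lshift _ k by exact: val_inj.
    by rewrite joint_constraints_pf pf mxE.
  have -> : l = rshift _ l' by exact: val_inj.
  case: (splitP l') => [a la|s ls].
    have -> : l' = lshift _ a by exact: val_inj.
    by rewrite joint_constraints_h hx mxE.
  have -> : l' = rshift _ s by exact: val_inj.
  rewrite joint_constraints_g mxE; apply/eqP.
  have : enum_val s \in active P (rsubmx z) by rewrite Sx; exact: enum_valP.
  by rewrite inE.
- exact: joint_independent.
- exact: joint_dependent.
- move=> z i q _ /state_coordP[i' ->].
  have -> : (fun y : 'rV[R]_((N + N) + state_dim N) => lsubmx y 0 q) =
      fun y => y 0 (lshift _ q) by apply/funext => y; rewrite mxE.
  by rewrite pd_coord eq_rlshift.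
- by rewrite card_state_coord; lia.
- by rewrite card_state_coord; lia.
- by lia.
Qed.

End Degenerate.

End Application.

Theorem proposition2 (R : realType) (N nI nJ r : nat)
    (P : acopf R N nI nJ) (Xi : set 'rV[R]_(N + N))
    (Xi_open : open Xi) (Xi_nonempty : Xi !=set0)
    (f_C1 : class_C 1 setT (opf_cost P))
    (r_large : (2 * N < r)%N)
    (h_Cr : class_C_at r (opf_X P) (opf_h P))
    (g_Cr : class_C_at r (opf_X P) (opf_g P))
    (rank_X : forall x, opf_X P x -> operational_regular P x)
    (v_pos : forall x, opf_X P x -> forall k : 'I_N, 0 < st_v x 0 k) :
  for_almost_every_in Xi (fun xi =>
    forall x, feasible P xi x -> LICQ P xi x).
Proof.
(* Finitely many active sets are possible, so their degenerate shunts together form a null set. *)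
have : lebesgue_null (\bigcup_(S in [set: {set 'I_nJ}]) (lsubmx @` degenerate P S)).
  by apply: lebesgue_null_count => S; exact: degenerate_null r_large h_Cr g_Cr rank_X v_pos S.
(* A failure of LICQ at a feasible [x] makes the joint point [row_mx xi x] degenerate for the active
   set of [x]. *)
apply: lebesgue_null_sub => xi [_ /existsNP[x /not_implyP[[pf hx gx] nlicq]]].
exists (active P x) => //; exists (row_mx xi x); last by rewrite row_mxKl.
by rewrite /degenerate /= row_mxKl row_mxKr; split.
Qed.
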